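(* Let $(f,G):E\to\mathbb{R}\times X$ be a $1$-jet defined on a subset $E$ of a Hilbert space $(X,|\cdot|)$, and suppose that $(f,G)$ is bounded on each bounded subset of $E$. Then there exists $F\in C^{1,u}_{\mathcal{B}}(X)$ with $(F,\nabla F)_{|_E}=(f,G)$ if and only if, for all bounded sequences $(x_n)\subset X$ and $(y_n),(z_n)\subset E$ with $|x_n-y_n|+|x_n-z_n|>0$ for all $n$, $$\lim_{n\to\infty}\left(|x_n-y_n|+|x_n-z_n|\right)=0\ \Longrightarrow\ \lim_{n\to\infty}\frac{f(y_n)+\langle G(y_n),x_n-y_n\rangle-f(z_n)-\langle G(z_n),x_n-z_n\rangle}{|x_n-y_n|+|x_n-z_n|}=0.$$
   Context: Spaces are real, and the dual of the Hilbert space $X$ is identified with $X$. A $1$-jet on $E$ is a pair of functions $f:E\to\mathbb{R}$, $G:E\to X$. $C^{1,u}_{\mathcal{B}}(X)$ is the space of all Fréchet differentiable functions $F:X\to\mathbb{R}$ whose derivative $\nabla F$ is uniformly continuous on each bounded subset of $X$. *)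

(* Defs.v *)
From HB Require Import structures.
From mathcomp Require Import all_boot all_order all_algebra.
From mathcomp Require Import all_classical all_reals all_analysis.

Set Implicit Arguments.
Unset Strict Implicit.
Unset Printing Implicit Defensive.

Import Order.TTheory GRing.Theory Num.Theory.
Import numFieldNormedType.Exports.

Local Open Scope classical_set_scope.
Local Open Scope ring_scope.

(* Real Hilbert spaces: a complete normed module whose norm comes from the
   positive definite symmetric bilinear form [dot]. *)
Definition norm_from_dot (R : realType) (X : normedModType R)
    (dot : {dot X for idfun}) : Prop :=
  forall x : X, `|x| ^+ 2 = dot x x.

(* Riesz representative of the Frechet differential ['d F x]; in a Hilbert
   space it exists and is unique as soon as [F] is differentiable at [x]. *)
Definition gradient (R : realType) (X : normedModType R)
    (dot : {dot X for idfun}) (F : X -> R) (x : X) : X :=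
  get [set g : X | forall v : X, 'd F x v = dot g v].

(* The uniform structure of [subspace B] is the one induced on [B], with the
   points outside [B] isolated: this is uniform continuity of the restriction
   of the gradient to [B]. *)
Definition C1uB (R : realType) (X : normedModType R)
    (dot : {dot X for idfun}) (F : X -> R) : Prop :=
  (forall x : X, differentiable F x) /\
  (forall B : set X, bounded_set B ->
     unif_continuous (gradient dot F : subspace B -> X)).

(* The subsets of [E] are the sets over the type of the elements of [E]. *)
Definition jet_bounded_on_bounded (R : realType) (X : normedModType R)
    (E : set X) (f : E -> R) (G : E -> X) : Prop :=
  forall B : set E, bounded_set [set val y | y in B] ->
    [bounded f y | y in B] /\ [bounded G y | y in B].

(* Main.v *)
Require Import Defs.
From HB Require Import structures.
From mathcomp Require Import all_boot all_order all_algebra.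
From mathcomp Require Import all_classical all_reals all_analysis.
From mathcomp Require Import ring lra.

Set Implicit Arguments.
Unset Strict Implicit.
Unset Printing Implicit Defensive.

Import Order.TTheory GRing.Theory Num.Theory.
Import numFieldNormedType.Exports.

Local Open Scope classical_set_scope.
Local Open Scope ring_scope.

(** Necessity is the mean value theorem. If [grad F] is uniformly continuous on
    bounded sets, the first-order remainder of [F] is little-o of the increment,
    uniformly on balls ([C1uB_uniformly_differentiable]). Comparing both Taylor
    polynomials at [y] and [z] with [F x] gives the limit.

    For sufficiency, the sequential condition says that on each bounded part of
    [E] the affine functions [A_y x = f y + <G y, x - y>] satisfy
    [A_y x - A_z x <= eps (|x - y| + |x - z|)] as soon as [|x - y| + |x - z|] is
    small. A sum of smoothed norms, with geometric weights and scales adapted to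
    this modulus, is a function [Phi] with [Phi h = o(|h|)] for which
    [A_y x - A_z x <= Phi (x - y) + Phi (x - z)] ([gauge_exists]). This [Phi] is
    paraconcave: it satisfies the concavity inequality up to a defect
    [t (1 - t) e |h|], where [e] is little-o at the origin.

    Let [F] be the supremum of all functions that are paraconvex with the same
    modulus [e] and lie below the barriers [A_y + Phi (. - y)]. The functions
    [A_z - Phi (. - z)] belong to this class, so [F] is squeezed between the two
    families of barriers and has the prescribed value and gradient at the points
    of the jet. As a supremum, [F] is paraconvex. It is also paraconcave: for
    fixed [t] and [h], the average of two translates of [F] minus the defect
    belongs to the class again, hence is at most [F] ([paraconvex_envelope]).
    Both inequalities together make the difference quotients of [F] Cauchy and
    their limit linear, with Taylor remainder at most [e |h|] at all base points
    ([paraconvex_concave_taylor]); the Riesz theorem turns the limit into a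
    gradient. This produces an extension of the jet from each bounded part of [E]
    ([bounded_jet_extension]).

    The extensions from the sets of [y] in [E] with [|y|^2 <= k + 1] are glued
    recursively with cutoffs that depend on [|x|^2]. Where a cutoff is
    neither [0] nor [1], the two functions that it mixes have the same jet at
    each point of [E], so that the mixture keeps this jet; on each ball the
    recursion is eventually constant ([uniformly_C1_gluing]). *)

(** * Hilbert space geometry and Riesz representation *)

Section InnerProduct.
Variables (R : realType) (X : normedModType R) (dot : {dot X for idfun}).
Hypothesis dotE : norm_from_dot dot.

Lemma dotC (x y : X) : dot x y = dot y x.
Proof. by rewrite (hermC dot) expr0 mul1r. Qed.

Lemma dotDl (x y z : X) : dot (x + y) z = dot x z + dot y z.
Proof. exact: linearDl. Qed.

Lemma dotDr (x y z : X) : dot z (x + y) = dot z x + dot z y.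
Proof. exact: linearDr. Qed.

Lemma dotZr (a : R) (x y : X) : dot x (a *: y) = a * dot x y.
Proof. exact: linearZr. Qed.

Lemma dotZl (a : R) (x y : X) : dot (a *: x) y = a * dot x y.
Proof. by rewrite dotC dotZr dotC. Qed.

Lemma dotNr (x y : X) : dot x (- y) = - dot x y.
Proof. exact: linearNr. Qed.

Lemma dotNl (x y : X) : dot (- x) y = - dot x y.
Proof. by rewrite dotC dotNr dotC. Qed.

Lemma dotBl (x y z : X) : dot (x - y) z = dot x z - dot y z.
Proof. by rewrite dotDl dotNl. Qed.

Lemma dotBr (x y z : X) : dot z (x - y) = dot z x - dot z y.
Proof. by rewrite dotDr dotNr. Qed.

Lemma normD_sq (x y : X) : `|x + y| ^+ 2 = `|x| ^+ 2 + 2 * dot x y + `|y| ^+ 2.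
Proof. by rewrite !dotE dotDl !dotDr (dotC y x); ring. Qed.

Lemma normB_sq (x y : X) : `|x - y| ^+ 2 = `|x| ^+ 2 - 2 * dot x y + `|y| ^+ 2.
Proof. by rewrite normD_sq dotNr normrN; ring. Qed.

Lemma dot_le (x y : X) : dot x y <= `|x| * `|y|.
Proof.
have := normD_sq x y.
have : `|x + y| ^+ 2 <= (`|x| + `|y|) ^+ 2.
  by rewrite ler_sqr ?nnegrE ?addr_ge0 ?normr_ge0 // ler_normD.
move=> H1 H2; rewrite H2 in H1; lra.
Qed.

Lemma norm_dot_le (x y : X) : `|dot x y| <= `|x| * `|y|.
Proof.
rewrite ler_norml dot_le andbT lerNl -dotNl.
by apply: le_trans (dot_le _ _) _; rewrite normrN.
Qed.

Lemma dot_inj (x y : X) : (forall v, dot x v = dot y v) -> x = y.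
Proof.
move=> H; apply/eqP; rewrite -subr_eq0 -normr_eq0 -sqrf_eq0 dotE.
by rewrite dotBl (H (x - y)) subrr.
Qed.

(** The parallelogram identity in the form used to show that minimizing
    sequences are Cauchy. *)
Lemma parallelogram_half (x y : X) :
  `|2^-1 *: (x + y)| ^+ 2 = 2^-1 * `|x| ^+ 2 + 2^-1 * `|y| ^+ 2
    - 4^-1 * `|x - y| ^+ 2.
Proof.
rewrite normB_sq normrZ exprMn normD_sq ger0_norm ?invr_ge0 //; lra.
Qed.

End InnerProduct.

Lemma le0_of_le_eps (R : realFieldType) (a : R) :
  (forall e, 0 < e -> a <= e) -> a <= 0.
Proof. by move=> H; apply/ler_addgt0Pl => e e0; rewrite addr0; exact: H. Qed.

Lemma quadratic_ge0_linear0 (R : realFieldType) (a b : R) : 0 <= b ->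
  (forall t, 0 <= t * a + t ^+ 2 * b) -> a = 0.
Proof.
move=> b0 H; have c0 : 0 < b + 1 by lra.
have := H (- a / (b + 1)).
have -> : - a / (b + 1) * a + (- a / (b + 1)) ^+ 2 * b
    = - (a / (b + 1)) ^+ 2.
  by field; rewrite gt_eqF.
rewrite oppr_ge0 => H1.
have /eqP : (a / (b + 1)) ^+ 2 = 0 by apply/eqP; rewrite eq_le H1 sqr_ge0.
by rewrite sqrf_eq0 mulf_eq0 invr_eq0 (gt_eqF c0) orbF => /eqP.
Qed.

Lemma inv_succ_small (R : realType) (e : R) : 0 < e ->
  exists n, n.+1%:R^-1 < e.
Proof.
move=> e0; have := near_infty_natSinv_lt (PosNum e0).
by move=> [n _ H]; exists n; exact: (H n (leqnn n)).
Qed.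

Lemma cauchy_seq_cvg (R : realType) (X : completeNormedModType R)
    (v : nat -> X) (b : nat -> R) :
  (forall n m, `|v n - v m| ^+ 2 <= b n + b m) ->
  (forall e, 0 < e -> exists N, forall n, (N <= n)%N -> b n <= e) ->
  exists l : X, v n @[n --> \oo] --> l.
Proof.
move=> vb b0; suff : cvgn v by move=> H; exists (limn v).
apply/cauchy_cvgP/cauchy_exP => e e0.
have e2 : 0 < (e / 2) ^+ 2 / 2 by rewrite divr_gt0 ?exprn_gt0 ?divr_gt0.
have [N HN] := b0 _ e2.
exists (v N); exists N => // n /= Nn.
rewrite -ball_normE /=.
have H : `|v N - v n| ^+ 2 <= (e / 2) ^+ 2.
  apply: le_trans (vb _ _) _; have := HN _ Nn; have := HN _ (leqnn N); lra.
have {}H : `|v N - v n| <= e / 2.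
  by rewrite -ler_sqr ?nnegrE ?normr_ge0 // divr_ge0 // ltW.
by apply: le_lt_trans H _; lra.
Qed.

Lemma sum_inv_succ_small (R : realType) (c e : R) : 0 <= c -> 0 < e ->
  exists N, forall n, (N <= n)%N -> c * n.+1%:R^-1 <= e.
Proof.
move=> c0 e0; have d0 : 0 < e / (c + 1) by rewrite divr_gt0 //; lra.
have [N HN] := inv_succ_small d0; exists N => n Nn.
have H : n.+1%:R^-1 <= e / (c + 1).
  apply: le_trans _ (ltW HN).
  by rewrite lef_pV2 ?posrE ?ltr0Sn // ler_nat.
have : c * n.+1%:R^-1 <= c * (e / (c + 1)) by rewrite ler_wpM2l.
have : c * (e / (c + 1)) <= e.
  by rewrite mulrA ler_pdivrMr; [nra|lra].
exact: (fun A B => le_trans B A).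
Qed.

(** The Riesz vector of [L] is the minimizer of [|v|^2 / 2 - L v]; minimizing
    sequences are Cauchy by the parallelogram identity. *)
Lemma riesz (R : realType) (X : completeNormedModType R)
    (dot : {dot X for idfun}) (dotE : norm_from_dot dot) (L : X -> R) (M : R) :
  (forall (a : R) u v, L (a *: u + v) = a * L u + L v) ->
  (forall v, `|L v| <= M * `|v|) ->
  exists g, forall v, L v = dot g v.
Proof.
move=> Llin LM.
pose J (v : X) := 2^-1 * `|v| ^+ 2 - L v.
have Jlb v : - (2^-1 * M ^+ 2) <= J v.
  have := LM v; rewrite ler_norml => /andP[_ H].
  have := sqr_ge0 (`|v| - M); rewrite /J; nra.
have Jinf : has_inf (range J).
  split; first by exists (J 0), 0.
  by exists (- (2^-1 * M ^+ 2)) => _ [v _ <-].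
pose i := inf (range J).
have iJ v : i <= J v by apply: ge_inf; [case: Jinf | exists v].
have /choice[v vP] : forall n, exists v, J v < i + n.+1%:R^-1.
  move=> n; have n0 : 0 < n.+1%:R^-1 :> R by rewrite invr_gt0 ltr0Sn.
  by have [_ [v _ <-] Hv] := inf_adherent n0 Jinf; exists v.
have L2 u w : L (2^-1 *: (u + w)) = 2^-1 * (L u + L w).
  have L0 : L 0 = 0 by have := Llin 1 0 0; rewrite scale1r addr0; lra.
  rewrite -[2^-1 *: _]addr0 Llin L0 addr0; congr (_ * _).
  by rewrite -[u]scale1r Llin mul1r scale1r.
have [g vg] : exists g : X, v n @[n --> \oo] --> g.
  apply: (@cauchy_seq_cvg _ _ v (fun n => 4 * n.+1%:R^-1)); last first.
    by move=> e e0; apply: sum_inv_succ_small.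
  move=> n m.
  have := iJ (2^-1 *: (v n + v m)).
  rewrite /J L2 (parallelogram_half dotE).
  have := vP n; have := vP m; rewrite /J /=.
  by move: (n.+1%:R^-1 : R) (m.+1%:R^-1 : R) => p q; lra.
exists g => w; apply/eqP; rewrite eq_sym -subr_eq0; apply/eqP.
apply: (@quadratic_ge0_linear0 _ _ (2^-1 * `|w| ^+ 2)) => [|t].
  by rewrite mulr_ge0 ?invr_ge0 ?sqr_ge0.
rewrite -oppr_le0; apply: le0_of_le_eps => e e0.
have e2 : 0 < e / (2 * (`|t| * `|w| + 1)).
  by rewrite divr_gt0 // mulr_gt0 // ltr_wpDl // mulr_ge0.
have [N1 _ H1] := (cvgrPdist_le _ _).1 vg _ e2.
have [N2 H2] := @sum_inv_succ_small R 1 _ ler01 (divr_gt0 e0 (ltr0Sn R 1)).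
pose n := maxn N1 N2.
have {}H1 := H1 n (leq_maxl _ _); have {}H2 := H2 n (leq_maxr _ _).
have := iJ (t *: w + v n); have := vP n.
have -> : J (t *: w + v n)
    = J (v n) + (t * (dot (v n) w - L w) + t ^+ 2 * (2^-1 * `|w| ^+ 2)).
  rewrite /J Llin (addrC (t *: w)) (normD_sq dotE) dotZr normrZ.
  rewrite exprMn real_normK ?num_real //. by field.
have H3 : t * (dot (v n) w - dot g w) <= e / 2.
  apply: le_trans (ler_norm _) _; rewrite -dotBl normrM.
  apply: (@le_trans _ _ (`|t| * (e / (2 * (`|t| * `|w| + 1)) * `|w|))).
    rewrite ler_wpM2l //; apply: le_trans (norm_dot_le dotE _ _) _.
    by rewrite ler_wpM2r // distrC.
  have := normr_ge0 t; have := normr_ge0 w; set a := `|t|; set b := `|w|.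
  move=> b0 a0; have ab : 0 <= a * b by rewrite mulr_ge0.
  have -> : a * (e / (2 * (a * b + 1)) * b) = e / 2 * ((a * b) / (a * b + 1)).
    by field; rewrite gt_eqF //; lra.
  have : (a * b) / (a * b + 1) <= 1 by rewrite ler_pdivrMr; lra.
  by move=> H; rewrite ler_piMr // ltW // divr_gt0.
move: H2; rewrite mul1r; move: (n.+1%:R^-1 : R) H3 => p H3 H2 H4 H5; lra.
Qed.

(** * Differentiability from two-sided paraconvexity *)

Definition small_modulus (R : realType) (e : R -> R) : Prop :=
  forall eps, 0 < eps -> exists2 d, 0 < d &
    forall s, 0 <= s <= d -> e s <= eps * s.

(** Convexity up to a small defect. The factor [t (1 - t)] in the defect matters:
    letting [t] tend to [0], it gives bounds on difference quotients, which a
    midpoint inequality with a little-o defect does not. *)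
Definition paraconvex (R : realType) (X : normedModType R) (e : R -> R)
    (u : X -> R) : Prop :=
  forall (t : R) (a h : X), 0 <= t <= 1 ->
    u (a + t *: h) <= (1 - t) * u a + t * u (a + h) + t * (1 - t) * e `|h|.

Definition paraconcave (R : realType) (X : normedModType R) (e : R -> R)
    (u : X -> R) : Prop :=
  forall (t : R) (a h : X), 0 <= t <= 1 ->
    (1 - t) * u a + t * u (a + h) <= u (a + t *: h) + t * (1 - t) * e `|h|.

Definition bounded_on_balls (R : realType) (X : normedModType R)
    (u : X -> R) : Prop :=
  forall r : R, exists M, forall a, `|a| <= r -> `|u a| <= M.

Lemma small_modulus_scaled (R : realType) (e : R -> R) (s eps : R) :
  small_modulus e -> 0 <= s -> 0 < eps ->
  exists N, forall n, (N <= n)%N -> n.+1%:R * e (n.+1%:R^-1 * s) <= eps.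
Proof.
move=> e_small s0 eps0.
have c0 : 0 < eps / (s + 1) by rewrite divr_gt0 //; lra.
have [d d0 Hd] := e_small _ c0.
have [N HN] := sum_inv_succ_small s0 d0; exists N => n Nn.
have n0 : 0 < n.+1%:R :> R by rewrite ltr0Sn.
have /Hd : 0 <= n.+1%:R^-1 * s <= d.
  by rewrite mulrC HN // andbT mulr_ge0 // invr_ge0 ltW.
move=> /(ler_wpM2l (ltW n0)) /le_trans; apply.
have -> : n.+1%:R * (eps / (s + 1) * (n.+1%:R^-1 * s)) = eps * (s / (s + 1)).
  by field; rewrite !gt_eqF //; lra.
by rewrite ler_piMr ?ltW // ltr_pdivrMr; lra.
Qed.

Lemma eq_of_dist_le_eps (R : realFieldType) (x y C : R) : 0 < C ->
  (forall eps, 0 < eps -> `|x - y| <= C * eps) -> x = y.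
Proof.
move=> C0 H; apply/eqP; rewrite -subr_eq0 -normr_eq0 eq_le normr_ge0 andbT.
apply: le0_of_le_eps => eps eps0.
have := H (eps / C) (divr_gt0 eps0 C0).
by rewrite mulrCA divff ?mulr1 // gt_eqF.
Qed.

Lemma cauchy_real_limit (R : realType) (q c : nat -> R) :
  (forall n m, (n <= m)%N -> `|q m - q n| <= c n) ->
  (forall eps, 0 < eps -> exists N, forall n, (N <= n)%N -> c n <= eps) ->
  exists l, forall n, `|l - q n| <= c n.
Proof.
move=> qc c0; have ql : cvgn q.
  apply: R_complete; apply: cauchy_exP => eps eps0.
  have [N HN] := c0 _ (divr_gt0 eps0 (ltr0Sn R 1)).
  exists (q N); exists N => // n /= Nn.
  rewrite -ball_normE /= distrC; apply: le_lt_trans (qc _ _ Nn) _.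
  by apply: le_lt_trans (HN _ (leqnn N)) _; lra.
exists (limn q) => n; apply/ler_addgt0Pr => eps eps0.
have [N _ HN] := (cvgrPdist_le _ _).1 ql _ eps0.
have H1 := HN (maxn n N) (leq_maxr _ _).
have H2 := qc n (maxn n N) (leq_maxl _ _).
rewrite -(subrKA (q (maxn n N))).
by apply: le_trans (ler_normD _ _) _; rewrite addrC lerD.
Qed.

Lemma linear_of_midpoint (R : realType) (X : lmodType R) (L : X -> R) :
  (forall h k, 2 * L (2^-1 *: (h + k)) = L h + L k) ->
  (forall (t : R) h, 0 <= t <= 1 -> L (t *: h) = t * L h) ->
  forall (a : R) u v, L (a *: u + v) = a * L u + L v.
Proof.
move=> Lmid Lhom.
have LD h k : L (h + k) = L h + L k.
  have H2 w : 2 * L w = L (2 *: w).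
    have h01 : 0 <= (2^-1 : R) <= 1 by apply/andP; split; lra.
    have := Lhom _ (2 *: w) h01.
    by rewrite scalerA mulVf ?pnatr_eq0 // scale1r => ->; lra.
  have := Lmid (2 *: h) (2 *: k); rewrite -!H2 -scalerDr scalerA mulVf ?pnatr_eq0 //.
  by rewrite scale1r; lra.
have LZ0 t h : 0 <= t -> L (t *: h) = t * L h.
  move=> t0; have [t1|t1] := leP t 1; first by rewrite Lhom // t0.
  have tp : 0 < t by lra.
  have := @Lhom t^-1 (t *: h); rewrite scalerA mulVf ?gt_eqF // scale1r.
  rewrite invr_ge0 t0 invf_le1 // ltW // => /(_ isT) ->.
  by rewrite mulrA divff ?mul1r // gt_eqF.
have L0 : L 0 = 0 by have := @LZ0 0 0 (lexx _); rewrite scale0r mul0r.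
have LN h : L (- h) = - L h.
  by have := LD h (- h); rewrite subrr L0; lra.
move=> a u v; rewrite LD; congr (_ + _).
have [a0|a0] := leP 0 a; first exact: LZ0.
by rewrite -[a]opprK scaleNr LN LZ0; [ring|lra].
Qed.

(** The convexity inequality forces the difference quotients [n D(h / n)] to be
    Cauchy; the midpoint inequality makes their limit additive. *)
Lemma linear_approximation (R : realType) (X : normedModType R) (e : R -> R)
    (D : X -> R) : small_modulus e ->
  (forall (t : R) h, 0 <= t <= 1 ->
     `|D (t *: h) - t * D h| <= t * (1 - t) * e `|h|) ->
  (forall h k, `|D h + D k - 2 * D (2^-1 *: (h + k))| <= e `|h - k|) ->
  exists L : X -> R,
    (forall (a : R) u v, L (a *: u + v) = a * L u + L v) /\
    (forall h, `|D h - L h| <= e `|h|).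
Proof.
move=> e_small Dt Dmid.
pose s n : R := n.+1%:R.
have s0 n : 0 < s n by rewrite ltr0Sn.
pose Q n h := s n * D ((s n)^-1 *: h).
pose c n (h : X) := s n * e ((s n)^-1 * `|h|).
have e0 (h : X) : 0 <= e `|h|.
  have := @Dt 2^-1 h; have : 0 <= (2^-1 : R) <= 1 by apply/andP; split; lra.
  by move=> -> /(_ isT); have := normr_ge0 (D (2^-1 *: h) - 2^-1 * D h); lra.
have normS n (h : X) : `|(s n)^-1 *: h| = (s n)^-1 * `|h|.
  by rewrite normrZ ger0_norm // invr_ge0 ltW.
have QC h n m : (n <= m)%N -> `|Q m h - Q n h| <= c n h.
  move=> nm; pose t := s n / s m.
  have t01 : 0 <= t <= 1.
    by rewrite /t divr_ge0 ?(ltW (s0 _)) //= ler_pdivrMr // mul1r ler_nat ltnS.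
  have := @Dt t ((s n)^-1 *: h) t01.
  have -> : t *: ((s n)^-1 *: h) = (s m)^-1 *: h.
    by rewrite scalerA /t mulrAC divff ?mul1r // gt_eqF.
  rewrite normS /Q /c => H.
  have -> : s m * D ((s m)^-1 *: h) - s n * D ((s n)^-1 *: h)
    = s m * (D ((s m)^-1 *: h) - t * D ((s n)^-1 *: h)).
    by rewrite /t; field; rewrite gt_eqF.
  rewrite normrM (ger0_norm (ltW (s0 m))).
  apply: le_trans (ler_wpM2l (ltW (s0 m)) H) _.
  have -> : s m * (t * (1 - t) * e ((s n)^-1 * `|h|))
    = s n * e ((s n)^-1 * `|h|) * (1 - t).
    by rewrite /t; field; rewrite gt_eqF.
  rewrite ler_piMr //; last by case/andP: t01; lra.
  by rewrite mulr_ge0 ?(ltW (s0 n)) // -normS.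
have c_small h eps : 0 < eps ->
    exists N, forall n, (N <= n)%N -> c n h <= eps.
  by move=> eps0; apply: small_modulus_scaled.
have /choice[L LQ] : forall h, exists l, forall n, `|l - Q n h| <= c n h.
  move=> h; apply: (@cauchy_real_limit R (fun n => Q n h) (fun n => c n h)).
    by move=> n m nm; apply: QC.
  exact: c_small.
exists L; split; last first.
  move=> h; have := LQ h 0%N.
  by rewrite /Q /c /s invr1 !mul1r scale1r distrC.
apply: linear_of_midpoint.
  move=> h k; apply/(@eq_of_dist_le_eps R _ _ 5) => [//|eps eps0].
  have [N1 H1] := c_small h _ eps0; have [N2 H2] := c_small k _ eps0.
  have [N3 H3] := c_small (2^-1 *: (h + k)) _ eps0.
  have [N4 H4] := c_small (h - k) _ eps0.
  pose n := maxn (maxn N1 N2) (maxn N3 N4).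
  have {}H1 : c n h <= eps by apply: H1; rewrite !leq_max leqnn.
  have {}H2 : c n k <= eps by apply: H2; rewrite !leq_max leqnn !orbT.
  have {}H3 : c n (2^-1 *: (h + k)) <= eps.
    by apply: H3; rewrite !leq_max leqnn !orbT.
  have {}H4 : c n (h - k) <= eps by apply: H4; rewrite !leq_max leqnn !orbT.
  have := Dmid ((s n)^-1 *: h) ((s n)^-1 *: k).
  rewrite -scalerDr -scalerBr normS scalerA (mulrC 2^-1) -scalerA.
  move=> /(ler_wpM2l (ltW (s0 n))) /le_trans /(_ H4).
  rewrite -[X in X * `|_|](ger0_norm (ltW (s0 n))) -normrM.
  move=> H5; have := le_trans (LQ h n) H1; have := le_trans (LQ k n) H2.
  have := le_trans (LQ (2^-1 *: (h + k)) n) H3; move: H5.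
  rewrite /Q !mulrBr !mulrDr !ler_norml => /andP[? ?] /andP[? ?] /andP[? ?].
  by move=> /andP[? ?]; apply/andP; split; lra.
move=> t h t01; apply/(@eq_of_dist_le_eps R _ _ 3) => [//|eps eps0].
have [N1 H1] := c_small h _ eps0; have [N2 H2] := c_small (t *: h) _ eps0.
pose n := maxn N1 N2.
have {}H1 : c n h <= eps by apply: H1; rewrite leq_max leqnn.
have {}H2 : c n (t *: h) <= eps by apply: H2; rewrite leq_max leqnn orbT.
have := @Dt t ((s n)^-1 *: h) t01.
rewrite normS scalerA (mulrC t) -scalerA => /(ler_wpM2l (ltW (s0 n))).
have : s n * (t * (1 - t) * e ((s n)^-1 * `|h|)) <= eps.
  have -> : s n * (t * (1 - t) * e ((s n)^-1 * `|h|)) = t * (1 - t) * c n h.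
    by rewrite /c; ring.
  apply: le_trans H1; rewrite ler_piMl //; last by nra.
  by rewrite mulr_ge0 ?(ltW (s0 n)) // -normS.
move=> A /le_trans/(_ A).
rewrite -[X in X * `|_|](ger0_norm (ltW (s0 n))) -normrM => B.
have T : `|t * (L h - Q n h)| <= eps.
  rewrite normrM (ger0_norm (proj1 (andP t01))).
  apply: le_trans (le_trans (LQ h n) H1).
  by rewrite ler_piMl //; case/andP: t01.
move: B T (le_trans (LQ (t *: h) n) H2).
by rewrite /Q !mulrBr (mulrCA t) !ler_norml; lra.
Qed.

(** At each base point the increments of [F] have a linear approximation, which
    is a bounded form because [F] is bounded on balls; the Riesz theorem then
    provides the gradient. Since [e] is the same at all base points, this is
    uniform differentiability. *)
Lemma paraconvex_concave_taylor (R : realType) (X : completeNormedModType R)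
    (dot : {dot X for idfun}) (dotE : norm_from_dot dot) (e : R -> R)
    (F : X -> R) :
  small_modulus e -> paraconvex e F -> paraconcave e F ->
  bounded_on_balls F ->
  exists g : X -> X,
    forall a h, `|F (a + h) - F a - dot (g a) h| <= e `|h|.
Proof.
move=> e_small Fvex Fcave Fb.
suff H a : exists ga, forall h, `|F (a + h) - F a - dot ga h| <= e `|h|.
  by have [g Hg] := choice H; exists g.
pose D h := F (a + h) - F a.
have e0 (h : X) : 0 <= e `|h|.
  have t01 : 0 <= (2^-1 : R) <= 1 by apply/andP; split; lra.
  by have := Fvex _ a h t01; have := Fcave _ a h t01; lra.
have [] := @linear_approximation R X e D e_small.
- move=> t h t01; have := Fvex _ a h t01; have := Fcave _ a h t01.
  by rewrite /D ler_norml; lra.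
- move=> h k; have t01 : 0 <= (2^-1 : R) <= 1 by apply/andP; split; lra.
  have := Fvex _ (a + k) (h - k) t01; have := Fcave _ (a + k) (h - k) t01.
  rewrite -!addrA (addrC h) addNKr.
  have -> : k + 2^-1 *: (- k + h) = 2^-1 *: (h + k).
    by rewrite scalerDr scalerN addrA (addrC h) scalerDr; congr (_ + _);
       rewrite -[X in X - _]scale1r -scalerBl; congr (_ *: _); lra.
  have := e0 (h - k); rewrite (addrC h) => E.
  by rewrite /D ler_norml; lra.
move=> L [Llin LD].
have [d d0 Hd] := e_small 1 ltr01.
have [M HM] := Fb (`|a| + d).
have L0 : L 0 = 0.
  by have := Llin 1 0 0; rewrite scale1r addr0; lra.
have LZ t h : L (t *: h) = t * L h.
  by have := Llin t h 0; rewrite !addr0 L0 addr0.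
have LM h : `|L h| <= ((2 * M + d) / d) * `|h|.
  have [->|h0] := eqVneq h 0; first by rewrite L0 !normr0 mulr0.
  have hp : 0 < `|h| by rewrite normr_gt0.
  pose t := d / `|h|; have tp : 0 < t by rewrite divr_gt0.
  have th : `|t *: h| = d.
    by rewrite normrZ gtr0_norm // /t mulfVK // gt_eqF.
  have : `|L (t *: h)| <= 2 * M + d.
    have := LD (t *: h); rewrite th.
    have : e d <= 1 * d by apply: Hd; rewrite lexx ltW.
    have := HM (a + t *: h).
    rewrite (le_trans (ler_normD _ _)) ?th // => /(_ isT).
    have := HM a; rewrite lerDl ltW // => /(_ isT).
    by rewrite /D !ler_norml; lra.
  rewrite LZ normrM gtr0_norm // /t => H.
  have : d * `|L h| <= (2 * M + d) * `|h|.
    by rewrite -ler_pdivrMr // mulrAC.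
  by rewrite mulrAC ler_pdivlMr // mulrC.
have [ga Hg] := riesz dotE Llin LM.
by exists ga => h; rewrite -Hg; apply: LD.
Qed.

(** * A gauge dominating a prescribed modulus *)

(** A smoothed norm: it is comparable with the norm at distance at least [d]
    from the origin, and at all points it is paraconcave both at the scale of
    the norm and, quadratically, with a constant of order [1 / d]. *)
Definition soft_norm (R : realType) (X : normedModType R) (d : R) (x : X) : R :=
  Num.sqrt (`|x| ^+ 2 + d ^+ 2) - d.

Section SoftNorm.
Variables (R : realType) (X : normedModType R) (dot : {dot X for idfun}).
Hypothesis dotE : norm_from_dot dot.
Variable d : R.
Hypothesis d0 : 0 < d.

Let S (x : X) := Num.sqrt (`|x| ^+ 2 + d ^+ 2).

Let S_sq x : S x ^+ 2 = `|x| ^+ 2 + d ^+ 2.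
Proof. by rewrite sqr_sqrtr // addr_ge0 ?sqr_ge0. Qed.

Let S_ge0 x : 0 <= S x. Proof. exact: sqrtr_ge0. Qed.

Let S_le x y : 0 <= y -> `|x| ^+ 2 + d ^+ 2 <= y ^+ 2 -> S x <= y.
Proof.
by move=> y0 H; rewrite -(ler_pXn2r (ltn0Sn 1)) ?nnegrE // S_sq.
Qed.

Let S_ge x y : 0 <= y -> y ^+ 2 <= `|x| ^+ 2 + d ^+ 2 -> y <= S x.
Proof.
by move=> y0 H; rewrite -(ler_pXn2r (ltn0Sn 1)) ?nnegrE // S_sq.
Qed.

Lemma soft_norm_ge0 (x : X) : 0 <= soft_norm d x.
Proof.
rewrite subr_ge0; apply: S_ge; first exact: ltW.
by rewrite lerDr sqr_ge0.
Qed.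

Lemma soft_norm_le (x : X) : soft_norm d x <= `|x|.
Proof.
rewrite lerBlDr; apply: S_le; first by rewrite addr_ge0 // ltW.
have : 0 <= `|x| * d by rewrite mulr_ge0 // ltW.
have -> : (`|x| + d) ^+ 2 = `|x| ^+ 2 + 2 * (`|x| * d) + d ^+ 2 by ring.
lra.
Qed.

Lemma soft_norm_ge_third (x : X) : d <= `|x| -> `|x| / 3 <= soft_norm d x.
Proof.
move=> dx; rewrite lerBrDr; apply: S_ge; first by rewrite addr_ge0 ?divr_ge0 // ltW.
have : 0 <= `|x| * (`|x| - d) by rewrite mulr_ge0 // subr_ge0.
by have := sqr_ge0 `|x|; rewrite !expr2; lra.
Qed.

Let S_lip x y : S x <= S y + `|x - y|.
Proof.
apply: S_le; first by rewrite addr_ge0.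
have yS : `|y| <= S y by apply: S_ge => //; rewrite lerDl sqr_ge0.
have H : `|x| <= `|y| + `|x - y| by rewrite -{1}(subrKC y x) ler_normD.
have : `|x| ^+ 2 <= (`|y| + `|x - y|) ^+ 2.
  by rewrite ler_sqr ?nnegrE ?addr_ge0.
have : `|y| * `|x - y| <= S y * `|x - y| by rewrite ler_wpM2r.
have := S_sq y.
have sqrD2 (a b : R) : (a + b) ^+ 2 = a ^+ 2 + 2 * (a * b) + b ^+ 2 by ring.
by rewrite !sqrD2; lra.
Qed.

Lemma soft_norm_paraconcave_linear :
  paraconcave (fun s => 2 * s) (@soft_norm R X d).
Proof.
move=> t a h /andP[t0 t1]; rewrite /soft_norm -/(S a) -/(S (a + h)).
rewrite -/(S (a + t *: h)).
have := S_lip a (a + t *: h); have := S_lip (a + h) (a + t *: h).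
have -> : a - (a + t *: h) = - (t *: h) by rewrite opprD addNKr.
have -> : a + h - (a + t *: h) = (1 - t) *: h.
  by rewrite opprD addrACA subrr add0r scalerBl scale1r.
rewrite normrN !normrZ !ger0_norm ?subr_ge0 // => H1 H2.
have t1' : 0 <= 1 - t by lra.
have := ler_wpM2l t0 H1; have := ler_wpM2l t1' H2; lra.
Qed.

Lemma soft_norm_paraconcave_quadratic :
  paraconcave (fun s => s ^+ 2 / d) (@soft_norm R X d).
Proof.
move=> t a h /andP[t0 t1]; rewrite /soft_norm -/(S a) -/(S (a + h)).
rewrite -/(S (a + t *: h)).
have id : (1 - t) * `|a| ^+ 2 + t * `|a + h| ^+ 2
    = `|a + t *: h| ^+ 2 + t * (1 - t) * `|h| ^+ 2.
  rewrite !(normD_sq dotE) dotZr normrZ exprMn real_normK ?num_real //; ring.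
have t1' : 0 <= 1 - t by lra.
have dS x : d <= S x by apply: S_ge; [exact: ltW | rewrite lerDr sqr_ge0].
have := S_sq a; have := S_sq (a + h); have := S_sq (a + t *: h).
have := dS (a + t *: h).
pose A := (1 - t) * S a + t * S (a + h).
have dA : d <= A.
  by have := ler_wpM2l t1' (dS a); have := ler_wpM2l t0 (dS (a + h)); rewrite /A; lra.
have A2 : A ^+ 2 <= (1 - t) * S a ^+ 2 + t * S (a + h) ^+ 2.
  have : 0 <= t * (1 - t) * (S a - S (a + h)) ^+ 2.
    by rewrite mulr_ge0 ?sqr_ge0 ?mulr_ge0.
  have -> : (1 - t) * S a ^+ 2 + t * S (a + h) ^+ 2
      = A ^+ 2 + t * (1 - t) * (S a - S (a + h)) ^+ 2 by rewrite /A; ring.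
  by rewrite lerDl.
move=> dm Hm Hh Ha; rewrite Ha Hh in A2.
have A3 : A ^+ 2 <= S (a + t *: h) ^+ 2 + t * (1 - t) * `|h| ^+ 2.
  by rewrite Hm; lra.
suff : A - S (a + t *: h) <= t * (1 - t) * (`|h| ^+ 2 / d).
  by rewrite /A; lra.
rewrite mulrA ler_pdivlMr //.
have [AS|SA] := leP A (S (a + t *: h)).
  apply: (@le_trans _ _ 0); first by rewrite pmulr_lle0 // subr_le0.
  by rewrite mulr_ge0 ?sqr_ge0 ?mulr_ge0.
have : (A - S (a + t *: h)) * d <= (A - S (a + t *: h)) * (A + S (a + t *: h)).
  apply: ler_wpM2l; first by rewrite subr_ge0 ltW.
  by rewrite (le_trans dA) // lerDl.
by rewrite -subr_sqr; lra.
Qed.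

End SoftNorm.

Lemma half_pow_sum (R : realType) (N n : nat) : (N <= n)%N ->
  \sum_(N <= k < n) (2^-1 : R) ^+ k = 2 * 2^-1 ^+ N - 2 * 2^-1 ^+ n.
Proof.
elim: n => [|n IH]; first by rewrite leqn0 => /eqP ->; rewrite big_nil subrr.
rewrite leq_eqVlt => /orP[/eqP ->|]; first by rewrite big_geq // subrr.
rewrite ltnS => Nn; rewrite big_nat_recr //= IH // exprS; lra.
Qed.

Lemma half_pow_small (R : realType) (c eps : R) : 0 <= c -> 0 < eps ->
  exists N, c * 2^-1 ^+ N <= eps.
Proof.
move=> c0 eps0; have [N /(_ N (leqnn N)) HN] := sum_inv_succ_small c0 eps0.
exists N; apply: le_trans HN; rewrite ler_wpM2l //.
rewrite exprVn lef_pV2 ?posrE ?exprn_gt0 ?ltr0Sn //.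
by rewrite -natrX ler_nat ltn_expl.
Qed.

(** For each fixed [N] the bound [s (K N s + c / 2 ^ N)] is small only up to the
    error [c / 2 ^ N]; the infimum is a single modulus that is little-o. *)
Definition inf_modulus (R : realType) (K : nat -> R) (c : R) (s : R) : R :=
  inf (range (fun N => s * (K N * s + c * 2^-1 ^+ N))).

Section InfModulus.
Variables (R : realType) (K : nat -> R) (c : R).
Hypotheses (K0 : forall N, 0 <= K N) (c0 : 0 <= c).

Lemma inf_modulus_le s N : 0 <= s ->
  inf_modulus K c s <= s * (K N * s + c * 2^-1 ^+ N).
Proof.
move=> s0; apply: ge_inf; last by exists N.
exists 0 => _ [n _ <-].
by rewrite mulr_ge0 // addr_ge0 ?mulr_ge0 // exprn_ge0 // invr_ge0.
Qed.

Lemma le_inf_modulus s a :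
  (forall N, a <= s * (K N * s + c * 2^-1 ^+ N)) -> a <= inf_modulus K c s.
Proof.
move=> H; apply: lb_le_inf; first by exists (s * (K 0%N * s + c * 2^-1 ^+ 0)), 0%N.
by move=> _ [n _ <-].
Qed.

Lemma inf_modulus_small : small_modulus (inf_modulus K c).
Proof.
move=> eps eps0; have e2 : 0 < eps / 2 by lra.
have [N HN] := half_pow_small c0 e2.
have k0 : 0 < K N + 1 by have := K0 N; lra.
exists (eps / 2 / (K N + 1)); first by rewrite divr_gt0.
move=> s /andP[s0 sd]; apply: le_trans (inf_modulus_le N s0) _.
rewrite mulrC ler_wpM2r //.
rewrite ler_pdivlMr // in sd; have := K0 N; nra.
Qed.

End InfModulus.

Section Gauge.
Variables (R : realType) (X : normedModType R) (dot : {dot X for idfun}).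
Hypothesis dotE : norm_from_dot dot.
Variables (d : nat -> R) (c : R).
Hypotheses (d0 : forall n, 0 < d n) (c0 : 0 <= c).

(* The factor [3] offsets the constant in [soft_norm_ge_third]. *)
Let w k : R := 3 * c * 2^-1 ^+ k.
Let w0 k : 0 <= w k.
Proof. by rewrite !mulr_ge0 // exprn_ge0 // invr_ge0. Qed.

Let P n (x : X) := \sum_(0 <= k < n) w k * soft_norm (d k) x.
Let K N := \sum_(0 <= k < N) w k / d k.

Let wsum N n : (N <= n)%N -> \sum_(N <= k < n) w k <= 6 * c * 2^-1 ^+ N.
Proof.
move=> Nn; rewrite -mulr_sumr half_pow_sum //.
have := c0; have : 0 <= 2^-1 ^+ n :> R by rewrite exprn_ge0 // invr_ge0.
by nra.
Qed.

Let P_le n x : P n x <= 6 * c * `|x|.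
Proof.
apply: (@le_trans _ _ ((\sum_(0 <= k < n) w k) * `|x|)).
  rewrite mulr_suml; apply: ler_sum => k _.
  by rewrite ler_wpM2l //; apply: soft_norm_le.
by rewrite ler_wpM2r //; have := wsum (leq0n n); rewrite expr0 mulr1.
Qed.

Let P_homo x : {homo P ^~ x : n m / (n <= m)%N >-> n <= m}.
Proof.
move=> n m nm; rewrite /P (@big_cat_nat _ _ _ n 0 m) //= lerDl sumr_ge0 // => k _.
by rewrite mulr_ge0 // soft_norm_ge0.
Qed.

Let Phi x := sup (range (P ^~ x)).

Let P_ub x : has_ubound (range (P ^~ x)).
Proof. by exists (6 * c * `|x|) => _ [n _ <-]; exact: P_le. Qed.

Let P_Phi n x : P n x <= Phi x.
Proof. by apply: ub_le_sup => //; exists n. Qed.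

Let Phi_le x a : (forall n, P n x <= a) -> Phi x <= a.
Proof.
move=> H; apply: ge_sup; first by exists (P 0 x), 0%N.
by move=> _ [n _ <-].
Qed.

Let P_paraconcave N n (t : R) (a h : X) : 0 <= t <= 1 -> (N <= n)%N ->
  (1 - t) * P n a + t * P n (a + h)
    <= P n (a + t *: h) + t * (1 - t) * (`|h| * (K N * `|h| + 12 * c * 2^-1 ^+ N)).
Proof.
move=> t01 Nn; have [t0 t1] := andP t01.
have tt : 0 <= t * (1 - t) by rewrite mulr_ge0 // subr_ge0.
pose E k := (1 - t) * soft_norm (d k) a + t * soft_norm (d k) (a + h)
  - soft_norm (d k) (a + t *: h).
have PE : (1 - t) * P n a + t * P n (a + h) - P n (a + t *: h)
    = \sum_(0 <= k < n) w k * E k.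
  rewrite /P !mulr_sumr -big_split /= -sumrB; apply: eq_bigr => k _.
  by rewrite /E; ring.
suff : \sum_(0 <= k < n) w k * E k
    <= t * (1 - t) * (`|h| * (K N * `|h| + 12 * c * 2^-1 ^+ N)) by lra.
rewrite (@big_cat_nat _ _ _ N) //=.
have HN : \sum_(0 <= k < N) w k * E k <= t * (1 - t) * (`|h| ^+ 2 * K N).
  rewrite /K !mulr_sumr; apply: ler_sum => k _.
  have := soft_norm_paraconcave_quadratic dotE (d0 k) a h t01.
  rewrite -lerBlDl => /(ler_wpM2l (w0 k)) /le_trans; apply.
  by rewrite le_eqVlt; apply/orP; left; apply/eqP; field; rewrite gt_eqF.
have Hn : \sum_(N <= k < n) w k * E k
    <= t * (1 - t) * (2 * `|h|) * \sum_(N <= k < n) w k.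
  rewrite mulr_sumr; apply: ler_sum => k _.
  have := @soft_norm_paraconcave_linear _ _ (d k) t a h t01.
  by rewrite -lerBlDl => H; rewrite [leRHS]mulrC; exact: ler_wpM2l.
have th : 0 <= t * (1 - t) * (2 * `|h|) by rewrite mulr_ge0 // mulr_ge0.
have := ler_wpM2l th (wsum Nn); lra.
Qed.

(** Summing soft norms at the scales [d n] with geometric weights yields a
    function that is at least [c / 2 ^ n] times the norm outside the ball of
    radius [d n], and still differentiable enough to be paraconcave with a
    modulus that is small at the origin. *)
Lemma gauge_exists : exists (e : R -> R) (Phi : X -> R),
  [/\ small_modulus e, paraconcave e Phi, Phi 0 = 0,
      (forall x, 0 <= Phi x <= 6 * c * `|x|) &
      (forall n x, d n <= `|x| -> c * 2^-1 ^+ n * `|x| <= Phi x)].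
Proof.
have K0 N : 0 <= K N by rewrite sumr_ge0 // => k _; rewrite divr_ge0 // ltW.
have c12 : 0 <= 12 * c by rewrite mulr_ge0.
exists (inf_modulus K (12 * c)), Phi; split.
- exact: inf_modulus_small.
- move=> t a h t01; have [t0 t1] := andP t01.
  have tt : 0 <= t * (1 - t) by rewrite mulr_ge0 // subr_ge0.
  have cvgP x := nondecreasing_cvgn (@P_homo x) (P_ub x).
  have H N : (1 - t) * Phi a + t * Phi (a + h) - Phi (a + t *: h)
      <= t * (1 - t) * (`|h| * (K N * `|h| + 12 * c * 2^-1 ^+ N)).
    have cv : ((1 - t) * P n a + t * P n (a + h)) @[n --> \oo]
        --> (1 - t) * Phi a + t * Phi (a + h).
      by apply: cvgD; apply: cvgMr; apply: cvgP.
    rewrite lerBlDr [leRHS]addrC -(cvg_lim (@Rhausdorff R) cv).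
    apply: limr_le; first by apply/cvg_ex; eexists; exact: cv.
    exists N => // n /= Nn; apply: le_trans (P_paraconcave a h t01 Nn) _.
    by rewrite lerD2r.
  rewrite -lerBlDl; have [tt0|tt0] := eqVneq (t * (1 - t)) 0.
    by have := H 0%N; rewrite tt0 !mul0r.
  have ttp : 0 < t * (1 - t) by rewrite lt_def tt0.
  rewrite -ler_pdivrMl //; apply: le_inf_modulus => N.
  by rewrite ler_pdivrMl.
- apply/eqP; rewrite eq_le; apply/andP; split.
    by apply: Phi_le => n; have := P_le n 0; rewrite normr0 mulr0.
  by have := P_Phi 0%N 0; rewrite /P big_nil.
- move=> x; apply/andP; split; first by have := P_Phi 0%N x; rewrite /P big_nil.
  by apply: Phi_le => n; exact: P_le.
- move=> n x dx; apply: le_trans (P_Phi n.+1 x); rewrite /P big_nat_recr //=.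
  have H1 : 0 <= \sum_(0 <= i < n) w i * soft_norm (d i) x.
    by apply: sumr_ge0 => k _; rewrite mulr_ge0 // soft_norm_ge0.
  have := ler_wpM2l (w0 n) (soft_norm_ge_third (d0 n) dx).
  by rewrite {1}/w; lra.
Qed.

End Gauge.

(** * Extension of a jet on a bounded set *)

(** Quantitative form of membership in the class of functions with gradient [g]
    uniformly continuous on bounded sets: the first-order remainder is little-o
    of the increment, uniformly over base points in a ball. *)
Definition uniformly_differentiable (R : realType) (X : normedModType R)
    (dot : {dot X for idfun}) (F : X -> R) (g : X -> X) : Prop :=
  forall r eps : R, 0 < eps -> exists2 d, 0 < d & forall a h,
    `|a| <= r -> `|h| <= d -> `|F (a + h) - F a - dot (g a) h| <= eps * `|h|.

Definition affine_jet (R : realType) (X : normedModType R)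
    (dot : {dot X for idfun}) (c : R) (p v : X) (x : X) : R :=
  c + dot v (x - p).

Section Envelope.
Variables (R : realType) (X : normedModType R) (dot : {dot X for idfun}).

Lemma affine_jet_comb (c : R) (p v a h : X) (t : R) :
  affine_jet dot c p v (a + t *: h)
  = (1 - t) * affine_jet dot c p v a + t * affine_jet dot c p v (a + h).
Proof. by rewrite /affine_jet !dotBr // !dotDr dotZr; ring. Qed.

Lemma affine_jetD (c : R) (p v h : X) :
  affine_jet dot c p v (p + h) = c + dot v h.
Proof. by rewrite /affine_jet (addrC p) addrK. Qed.

Variables (e : R -> R) (Phi : X -> R).
Hypothesis Phi_cave : paraconcave e Phi.

Let Phi_shift (t : R) p a h : 0 <= t <= 1 ->
  (1 - t) * Phi (a - p) + t * Phi (a + h - p)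
    <= Phi (a + t *: h - p) + t * (1 - t) * e `|h|.
Proof. by move=> t01; rewrite !(addrAC a _ (- p)); apply: Phi_cave. Qed.

(** The supremum of all paraconvex functions below the upper barriers lies
    above the lower barriers, since these belong to the class. The class is
    stable under translations and convex combinations; hence the average of
    translates of the supremum, lowered by the paraconcavity defect of the
    barriers, belongs to it too, which is paraconcavity of the supremum. *)
Lemma paraconvex_envelope (I : Type) (A : set I) (f : I -> R) (p G : I -> X) :
  A !=set0 ->
  (forall i j x, A i -> A j ->
     affine_jet dot (f i) (p i) (G i) x - affine_jet dot (f j) (p j) (G j) x
       <= Phi (x - p i) + Phi (x - p j)) ->
  exists F : X -> R, [/\ paraconvex e F, paraconcave e F &
    forall i x, A i ->
      `|F x - affine_jet dot (f i) (p i) (G i) x| <= Phi (x - p i)].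
Proof.
move=> [i0 Ai0] compat.
pose T i := affine_jet dot (f i) (p i) (G i).
pose S := [set u : X -> R | paraconvex e u /\
  forall i x, A i -> u x <= T i x + Phi (x - p i)].
have lowS i : A i -> S (fun x => T i x - Phi (x - p i)).
  move=> Ai; split; last first.
    by move=> j x Aj; have := compat i j x Ai Aj; rewrite -/(T i x) -/(T j x); lra.
  move=> t a h t01; rewrite /T affine_jet_comb.
  by have := Phi_shift (p i) a h t01; lra.
pose F x := sup [set u x | u in S].
have leF u x : S u -> u x <= F x.
  move=> Su; apply: ub_le_sup; last by exists u.
  by exists (T i0 x + Phi (x - p i0)) => _ [v [_ vT] <-]; exact: vT.
have Fle x b : (forall u, S u -> u x <= b) -> F x <= b.
  move=> H; apply: ge_sup; last by move=> _ [u Su <-]; exact: H.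
  by eexists; exists (fun x => T i0 x - Phi (x - p i0)); first exact: lowS.
have FT i x : A i -> F x <= T i x + Phi (x - p i).
  by move=> Ai; apply: Fle => u [_]; exact.
have Fvex : paraconvex e F.
  move=> t a h t01; apply: Fle => u Su; have [t0 t1] := andP t01.
  apply: le_trans (Su.1 t a h t01) _.
  rewrite lerD2r lerD // ler_wpM2l ?subr_ge0 //; exact: leF.
exists F; split => // [t a h t01|i x Ai]; last first.
  rewrite ler_norml -/(T i x); have := FT i x Ai; have := leF _ x (lowS i Ai).
  by lra.
pose v x := (1 - t) * F (x - t *: h) + t * F (x - t *: h + h)
  - t * (1 - t) * e `|h|.
have Sv : S v.
  have [t0 t1] := andP t01; have t1' : 0 <= 1 - t by rewrite subr_ge0.
  split=> [s b k s01|i x Ai]; rewrite /v.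
    have := ler_wpM2l t1' (Fvex s (b - t *: h) k s01).
    have := ler_wpM2l t0 (Fvex s (b - t *: h + h) k s01).
    rewrite !(addrAC b _ (- (t *: h))) !(addrAC (b - t *: h) _ h).
    move: (F _) (F _) (F _) (F _) (F _) (F _) => *; lra.
  have := ler_wpM2l t1' (FT i (x - t *: h) Ai).
  have := ler_wpM2l t0 (FT i (x - t *: h + h) Ai).
  have := Phi_shift (p i) (x - t *: h) h t01.
  have := affine_jet_comb (f i) (p i) (G i) (x - t *: h) h t.
  by rewrite subrK -/(T i x); rewrite /T; lra.
by have := leF v (a + t *: h) Sv; rewrite /v addrK; lra.
Qed.

End Envelope.

Lemma dot_small_eq0 (R : realType) (X : normedModType R)
    (dot : {dot X for idfun}) (dotE : norm_from_dot dot) (v : X) :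
  (forall eps, 0 < eps -> exists2 d, 0 < d &
     forall h, `|h| <= d -> `|dot v h| <= eps * `|h|) -> v = 0.
Proof.
move=> H; apply/eqP; rewrite -normr_eq0 eq_le normr_ge0 andbT.
apply: le0_of_le_eps => eps eps0; have [d d0 Hd] := H _ eps0.
have [->|v0] := eqVneq v 0; first by rewrite normr0 ltW.
have vp : 0 < `|v| by rewrite normr_gt0.
have := Hd ((d / `|v|) *: v).
rewrite normrZ ger0_norm ?divr_ge0 ?(ltW d0) // mulfVK ?gt_eqF // => /(_ (lexx _)).
rewrite dotZr -dotE ger0_norm; last first.
  by rewrite mulr_ge0 ?sqr_ge0 // divr_ge0 // ltW.
by rewrite expr2 mulrA mulfVK ?gt_eqF // mulrC ler_pM2r.
Qed.

(** The Taylor remainder of the envelope and the barriers around it are both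
    little-o, which identifies the gradient at the points of the jet. *)
Lemma jet_extension_of_gauge (R : realType) (X : completeNormedModType R)
    (dot : {dot X for idfun}) (dotE : norm_from_dot dot) (e : R -> R)
    (Phi : X -> R) (C : R) (I : Type) (A : set I) (f : I -> R) (p G : I -> X) :
  small_modulus e -> paraconcave e Phi -> Phi 0 = 0 ->
  (forall x, 0 <= Phi x <= C * `|x|) ->
  A !=set0 ->
  (forall i j x, A i -> A j ->
     affine_jet dot (f i) (p i) (G i) x - affine_jet dot (f j) (p j) (G j) x
       <= Phi (x - p i) + Phi (x - p j)) ->
  exists F g, [/\ bounded_on_balls F, uniformly_differentiable dot F g &
    forall i, A i -> F (p i) = f i /\ g (p i) = G i].
Proof.
move=> e_small Phi_cave Phi0 PhiC A0 compat.
have [F [Fvex Fcave FT]] := paraconvex_envelope Phi_cave A0 compat.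
have Fb : bounded_on_balls F.
  have [i Ai] := A0 => r.
  exists (`|f i| + (`|G i| + `|C|) * (r + `|p i|)) => x xr.
  have H1 := FT i x Ai; have /andP[_ H2] := PhiC (x - p i).
  have H3 : `|x - p i| <= r + `|p i|.
    by apply: le_trans (ler_normB _ _) _; rewrite lerD2r.
  have H4 := norm_dot_le dotE (G i) (x - p i).
  have H5 := ler_wpM2l (normr_ge0 (G i)) H3.
  have H6 := ler_wpM2l (normr_ge0 C) H3.
  have H7 : C * `|x - p i| <= `|C| * `|x - p i|.
    by rewrite ler_wpM2r // ler_norm.
  have := ler_norm (f i); have := ler_norm (- f i); rewrite normrN.
  move: H1 H4; rewrite /affine_jet !ler_norml mulrDl => *.
  by apply/andP; split; lra.
have [g Hg] := paraconvex_concave_taylor dotE e_small Fvex Fcave Fb.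
exists F, g; split => //.
  move=> r eps eps0; have [d d0 Hd] := e_small _ eps0; exists d => // a h _ hd.
  by apply: le_trans (Hg a h) _; apply: Hd; rewrite normr_ge0.
move=> i Ai; have Fp : F (p i) = f i.
  have := FT i (p i) Ai; rewrite subrr Phi0 /affine_jet subrr linear0r addr0.
  by rewrite normr_le0 subr_eq0 => /eqP.
split => //; apply/eqP; rewrite -subr_eq0; apply/eqP.
apply: (dot_small_eq0 dotE) => eps eps0.
have eps2 : 0 < eps / 2 by rewrite divr_gt0.
have [d d0 Hd] := e_small _ eps2; exists (d / 2); first by rewrite divr_gt0.
move=> h hd; have h0 := normr_ge0 h.
have e1 : e `|h| <= eps / 2 * `|h| by apply: Hd; rewrite h0; lra.
have e2 : e (2 * `|h|) <= eps / 2 * (2 * `|h|).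
  by apply: Hd; apply/andP; split; lra.
have Phih : Phi h <= 2^-1 * e (2 * `|h|).
  have t01 : 0 <= (2^-1 : R) <= 1 by apply/andP; split; lra.
  have := Phi_cave _ (- h) (2 *: h) t01.
  rewrite scalerA mulVf ?pnatr_eq0 // scale1r addNr Phi0 normrZ ger0_norm //.
  have -> : - h + 2 *: h = h by rewrite scaler_nat mulr2n addKr.
  by have /andP[] := PhiC (- h); lra.
have := Hg (p i) h; have := FT i (p i + h) Ai.
rewrite affine_jetD (addrC (p i)) addrK -(addrC (p i)) Fp dotBl // !ler_norml => H1 H2.
by apply/andP; split; lra.
Qed.

(** Compatibility of the first-order Taylor polynomials at a sequence of scales
    provides the scales of the gauge; at distances above the first scale, the
    bound on the jet suffices. *)
Lemma bounded_jet_extension (R : realType) (X : completeNormedModType R)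
    (dot : {dot X for idfun}) (dotE : norm_from_dot dot)
    (I : Type) (A : set I) (f : I -> R) (p G : I -> X) (K : R) :
  (forall i, A i -> `|f i| <= K /\ `|G i| <= K) ->
  (forall eps, 0 < eps -> exists2 d, 0 < d & forall i j x, A i -> A j ->
     `|x - p i| + `|x - p j| <= d ->
     affine_jet dot (f i) (p i) (G i) x - affine_jet dot (f j) (p j) (G j) x
       <= eps * (`|x - p i| + `|x - p j|)) ->
  exists F g, [/\ bounded_on_balls F, uniformly_differentiable dot F g &
    forall i, A i -> F (p i) = f i /\ g (p i) = G i].
Proof.
move=> fGK compat; have [A0|] := pselect (A !=set0); last first.
  move=> A0; exists (fun=> 0), (fun=> 0); split.
  - by move=> r; exists 0 => a _; rewrite normr0.
  - move=> r eps eps0; exists 1 => // a h _ _.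
    by rewrite linear0l !subr0 normr0 mulr_ge0 // ltW.
  - by move=> i Ai; exfalso; apply: A0; exists i.
have K0 : 0 <= K by have [i /fGK[]] := A0; have := normr_ge0 (f i); lra.
have half0 n : 0 < 2^-1 ^+ n :> R by rewrite exprn_gt0 // invr_gt0.
have /choice[d Hd] : forall n, exists d, 0 < d /\ forall i j x, A i -> A j ->
    `|x - p i| + `|x - p j| <= d ->
    affine_jet dot (f i) (p i) (G i) x - affine_jet dot (f j) (p j) (G j) x
      <= 2^-1 ^+ n * (`|x - p i| + `|x - p j|).
  by move=> n; have [d d0 Hd] := compat _ (half0 n); exists d.
pose d' n := d n / 2.
have d'0 n : 0 < d' n by rewrite divr_gt0 //; case: (Hd n).
(* [4] pays for the compatibility moduli between consecutive scales; the other
   terms pay for the discrepancy [2 K + 2 K |w|] beyond the first scale. *)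
pose c := 4 + 2 * K + 2 * K / d' 0%N.
have Kd0 : 0 <= 2 * K / d' 0%N by rewrite divr_ge0 ?(ltW (d'0 _)) // mulr_ge0.
have c4 : 4 <= c by rewrite /c; lra.
have c0 : 0 <= c by lra.
have [e [Phi [e_small Phi_cave Phi0 PhiC Phi_ge]]] := gauge_exists dotE d'0 c0.
apply: (jet_extension_of_gauge dotE e_small Phi_cave Phi0 PhiC A0).
move=> i j x Ai Aj; set D := _ - _.
(* The point of the jet farther from [x] pays for the whole discrepancy. *)
suff far w : `|x - p i| <= `|w| -> `|x - p j| <= `|w| -> D <= Phi w.
  have /andP[Pi _] := PhiC (x - p i); have /andP[Pj _] := PhiC (x - p j).
  have [ij|ji] := leP `|x - p i| `|x - p j|.
    by have := far _ ij (lexx _); lra.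
  by have := far _ (lexx _) (ltW ji); lra.
move=> iw jw; have /andP[Pw _] := PhiC w.
have [[n0 Hn0]|far_all] := pselect (exists n, d' n <= `|w|); last first.
  apply: le_trans Pw; apply: le0_of_le_eps => eps eps0.
  have s0 : 0 <= `|x - p i| + `|x - p j| by rewrite addr_ge0.
  have [n Hn] := half_pow_small s0 eps0.
  apply: le_trans Hn; rewrite mulrC; apply: (Hd n).2 => //.
  have : `|w| < d' n by rewrite ltNge; apply/negP => dw; apply: far_all; exists n.
  by rewrite /d'; lra.
have ex_n : exists n, d' n <= `|w| by exists n0.
case: (ex_minnP ex_n) => -[|n] Hn n_min.
  apply: le_trans (Phi_ge _ _ Hn); rewrite expr0 mulr1.
  have [fi Gi] := fGK i Ai; have [fj Gj] := fGK j Aj.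
  have Ki := le_trans (norm_dot_le dotE (G i) (x - p i))
    (ler_pM (normr_ge0 _) (normr_ge0 _) Gi iw).
  have Kj := le_trans (norm_dot_le dotE (G j) (x - p j))
    (ler_pM (normr_ge0 _) (normr_ge0 _) Gj jw).
  have Kw : 2 * K <= 2 * K / d' 0%N * `|w|.
    by rewrite -mulrA ler_peMr ?mulr_ge0 // mulrC ler_pdivlMr ?mul1r.
  move: Ki Kj fi fj; rewrite /D /affine_jet /c !ler_norml !mulrDl.
  by have := normr_ge0 w; lra.
have dn : `|w| < d' n.
  by rewrite ltNge; apply/negP => /n_min; rewrite ltnn.
have Hs : D <= 2^-1 ^+ n * (`|x - p i| + `|x - p j|).
  by apply: (Hd n).2 => //; move: dn; rewrite /d'; lra.
apply: le_trans Hs _; apply: le_trans (Phi_ge _ _ Hn).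
have hw : 0 <= 2^-1 ^+ n * `|w| by rewrite mulr_ge0 // ltW.
have := ler_wpM2l (ltW (half0 n)) iw; have := ler_wpM2l (ltW (half0 n)) jw.
have := ler_wpM2r hw c4.
by rewrite exprS mulrDr; lra.
Qed.

(** * Gluing local extensions with differentiable cutoffs *)

Section UniformC1.
Variables (R : realType) (X : normedModType R) (dot : {dot X for idfun}).
Hypothesis dotE : norm_from_dot dot.

(** Boundedness on balls is carried along because it bounds the gradient and the
    error terms of products. *)
Definition uniformly_C1 (F : X -> R) (g : X -> X) : Prop :=
  bounded_on_balls F /\ uniformly_differentiable dot F g.

Lemma bounded_on_balls_pos (F : X -> R) (r : R) : bounded_on_balls F ->
  exists2 M, 0 <= M & forall a, `|a| <= r -> `|F a| <= M.
Proof.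
move=> /(_ r)[M HM]; exists `|M| => // a /HM /le_trans; apply; exact: ler_norm.
Qed.

Lemma uniformly_C1_grad_bounded F g (r : R) : uniformly_C1 F g ->
  exists2 M, 0 <= M & forall a, `|a| <= r -> `|g a| <= M.
Proof.
move=> [Fb Fg]; have [d d0 Hd] := Fg r 1 ltr01.
have [M M0 HM] := bounded_on_balls_pos (r + d) Fb.
exists ((2 * M + d) / d).
  by rewrite divr_ge0 ?(ltW d0) // addr_ge0 ?(ltW d0) // mulr_ge0.
move=> a ar; have [->|g0] := eqVneq (g a) 0.
  by rewrite normr0 divr_ge0 ?(ltW d0) // addr_ge0 ?(ltW d0) // mulr_ge0.
have gp : 0 < `|g a| by rewrite normr_gt0.
pose h := (d / `|g a|) *: g a.
have hd : `|h| = d.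
  by rewrite normrZ ger0_norm ?divr_ge0 ?(ltW d0) // mulfVK // gt_eqF.
have gh : dot (g a) h = d * `|g a|.
  by rewrite dotZr -dotE expr2 mulrA mulfVK // gt_eqF.
rewrite ler_pdivlMr // mulrC -gh.
have := Hd a h ar; rewrite hd => /(_ (lexx _)).
have := HM a; rewrite (le_trans ar) ?lerDl ?(ltW d0) // => /(_ isT).
have := HM (a + h); rewrite (le_trans (ler_normD _ _)) ?hd ?lerD2r // => /(_ isT).
by rewrite !ler_norml; lra.
Qed.

Lemma uniformly_C1_lipschitz F g (r : R) : uniformly_C1 F g ->
  exists2 L, 0 <= L & exists2 d, 0 < d & forall a h,
    `|a| <= r -> `|h| <= d -> `|F (a + h) - F a| <= L * `|h|.
Proof.
move=> Fg; have [M M0 HM] := uniformly_C1_grad_bounded r Fg.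
have [d d0 Hd] := Fg.2 r 1 ltr01; exists (M + 1); first by rewrite addr_ge0.
exists d => // a h ar hd; have := Hd a h ar hd.
have := le_trans (norm_dot_le dotE (g a) h) (ler_wpM2r (normr_ge0 h) (HM a ar)).
by rewrite !ler_norml mulrDl; lra.
Qed.

Lemma uniformly_C1_ext F F' g g' : F =1 F' -> g =1 g' ->
  uniformly_C1 F g -> uniformly_C1 F' g'.
Proof. by move=> /funext -> /funext ->. Qed.

Lemma uniformly_C1_cst (c : R) : uniformly_C1 (fun=> c) (fun=> 0).
Proof.
split; first by move=> r; exists `|c|.
move=> r eps eps0; exists 1 => // a h _ _.
by rewrite subrr linear0l subrr normr0 mulr_ge0 // ltW.
Qed.

Lemma uniformly_C1_lin (c : R) F g F' g' : uniformly_C1 F g -> uniformly_C1 F' g' ->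
  uniformly_C1 (fun x => c * F x + F' x) (fun x => c *: g x + g' x).
Proof.
move=> [Fb Fg] [Fb' Fg']; split.
  move=> r; have [M HM] := Fb r; have [M' HM'] := Fb' r.
  exists (`|c| * M + M') => a ar; apply: le_trans (ler_normD _ _) _.
  by rewrite normrM lerD ?HM' // ler_wpM2l ?HM.
move=> r eps eps0.
have c1 : 0 < `|c| + 1 by have := normr_ge0 c; lra.
have e1 : 0 < eps / (`|c| + 1) by rewrite divr_gt0.
have [d d0 Hd] := Fg r _ e1; have [d' d'0 Hd'] := Fg' r _ e1.
exists (Num.min d d'); first by rewrite lt_min d0 d'0.
move=> a h ar; rewrite le_min => /andP[hd hd'].
have -> : c * F (a + h) + F' (a + h) - (c * F a + F' a) - dot (c *: g a + g' a) h
   = c * (F (a + h) - F a - dot (g a) h) + (F' (a + h) - F' a - dot (g' a) h).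
  by rewrite dotDl dotZl; ring.
apply: le_trans (ler_normD _ _) _; rewrite normrM.
have := ler_wpM2l (normr_ge0 c) (Hd a h ar hd); have := Hd' a h ar hd'.
have -> : eps * `|h| = `|c| * (eps / (`|c| + 1) * `|h|) + eps / (`|c| + 1) * `|h|.
  by field; rewrite gt_eqF.
by move=> A B; apply: lerD.
Qed.

(** In products and compositions the error splits into a term linear in
    remainders of the factors and a term quadratic in the increment. *)
Lemma remainder_radius (A B eps : R) : 0 <= A -> 0 <= B -> 0 < eps ->
  exists eps' d, [/\ 0 < eps', 0 < d & forall s, 0 <= s -> s <= d ->
    A * (eps' * s) + B * s ^+ 2 <= eps * s].
Proof.
move=> A0 B0 eps0; exists (eps / 2 / (A + 1)), (eps / 2 / (B + 1)).
have e2 : 0 < eps / 2 by rewrite divr_gt0.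
have A1 : 0 < A + 1 by lra.
have B1 : 0 < B + 1 by lra.
split; [exact: divr_gt0 | exact: divr_gt0 | move=> s s0 sd].
have HA : A * (eps / 2 / (A + 1)) <= eps / 2.
  by rewrite mulrA ler_pdivrMr //; nra.
have HB : B * s <= eps / 2.
  by move: sd; rewrite ler_pdivlMr //; nra.
have := ler_wpM2r s0 HA; have := ler_wpM2r s0 HB; rewrite expr2; lra.
Qed.

Lemma uniformly_C1_mul F g F' g' : uniformly_C1 F g -> uniformly_C1 F' g' ->
  uniformly_C1 (fun x => F x * F' x) (fun x => F x *: g' x + F' x *: g x).
Proof.
move=> Fg Fg'; split.
  move=> r; have [M HM] := Fg.1 r; have [M' HM'] := Fg'.1 r.
  exists (M * M') => a ar; rewrite normrM.
  by apply: ler_pM => //; [apply: HM | apply: HM'].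
move=> r eps eps0.
have [M M0 HM] := bounded_on_balls_pos r Fg.1.
have [M' M'0 HM'] := bounded_on_balls_pos r Fg'.1.
have [L L0 [d1 d10 HL]] := uniformly_C1_lipschitz r Fg.
have [L' L'0 [d2 d20 HL']] := uniformly_C1_lipschitz r Fg'.
have [eps1 [d3 [eps10 d30 H3]]] :=
  remainder_radius (addr_ge0 M0 M'0) (mulr_ge0 L0 L'0) eps0.
have [d4 d40 H4] := Fg.2 r _ eps10; have [d5 d50 H5] := Fg'.2 r _ eps10.
exists (Num.min (Num.min d1 d2) (Num.min d3 (Num.min d4 d5))).
  by rewrite !lt_min d10 d20 d30 d40 d50.
move=> a h ar; rewrite !le_min.
move=> /andP[/andP[h1 h2] /andP[h3 /andP[h4 h5]]].
have -> : F (a + h) * F' (a + h) - F a * F' a - dot (F a *: g' a + F' a *: g a) h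
    = F a * (F' (a + h) - F' a - dot (g' a) h)
      + F' a * (F (a + h) - F a - dot (g a) h)
      + (F (a + h) - F a) * (F' (a + h) - F' a).
  by rewrite dotDl !dotZl; ring.
apply: le_trans (H3 `|h| (normr_ge0 _) h3).
have := ler_pM (normr_ge0 _) (normr_ge0 _) (HL a h ar h1) (HL' a h ar h2).
have := ler_pM (normr_ge0 _) (normr_ge0 _) (HM a ar) (H5 a h ar h5).
have := ler_pM (normr_ge0 _) (normr_ge0 _) (HM' a ar) (H4 a h ar h4).
rewrite -!normrM => A B C.
apply: le_trans (ler_normD _ _) _; apply: le_trans (lerD (ler_normD _ _) (lexx _)) _.
by move: (lerD (lerD B A) C); rewrite expr2; lra.
Qed.

Let pos (t : R) := Num.max t 0.

Let pos_sq_taylor (t u : R) :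
  0 <= pos (t + u) ^+ 2 - pos t ^+ 2 - 2 * pos t * u <= u ^+ 2.
Proof.
rewrite /pos /Num.max; case: ltP => tu; case: ltP => t0;
  rewrite ?expr0n /=; apply/andP; split; rewrite ?expr2; nra.
Qed.

(** Squared positive parts are the building blocks of the cutoffs: unlike the
    positive part itself they are differentiable. *)
Lemma uniformly_C1_pos_sq F g : uniformly_C1 F g ->
  uniformly_C1 (fun x => Num.max (F x) 0 ^+ 2) (fun x => (2 * Num.max (F x) 0) *: g x).
Proof.
have pos_le (t : R) : 0 <= pos t <= `|t|.
  by rewrite /pos le_max lexx orbT /= ge_max ler_norm normr_ge0.
move=> Fg; split.
  move=> r; have [M HM] := Fg.1 r; exists (M ^+ 2) => a ar.
  have /andP[p0 pF] := pos_le (F a).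
  rewrite normrX -/(pos _) (ger0_norm p0) !expr2.
  by apply: ler_pM => //; apply: le_trans pF (HM a ar).
move=> r eps eps0.
have [M M0 HM] := bounded_on_balls_pos r Fg.1.
have [L L0 [d1 d10 HL]] := uniformly_C1_lipschitz r Fg.
have M2 : 0 <= 2 * M by rewrite mulr_ge0.
have [eps1 [d3 [eps10 d30 H3]]] := remainder_radius M2 (sqr_ge0 L) eps0.
have [d4 d40 H4] := Fg.2 r _ eps10.
exists (Num.min d1 (Num.min d3 d4)); first by rewrite !lt_min d10 d30 d40.
move=> a h ar; rewrite !le_min => /and3P[h1 h3 h4].
apply: le_trans (H3 `|h| (normr_ge0 _) h3).
rewrite -!/(pos _) dotZl.
have := pos_sq_taylor (F a) (F (a + h) - F a); rewrite subrKC.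
set D := F (a + h) - F a => /andP[T0 T1].
have -> : pos (F (a + h)) ^+ 2 - pos (F a) ^+ 2 - 2 * pos (F a) * dot (g a) h
    = (pos (F (a + h)) ^+ 2 - pos (F a) ^+ 2 - 2 * pos (F a) * D)
      + 2 * pos (F a) * (D - dot (g a) h) by ring.
apply: le_trans (ler_normD _ _) _; rewrite (ger0_norm T0) addrC; apply: lerD.
  have /andP[p0 pF] := pos_le (F a).
  rewrite normrM ger0_norm ?mulr_ge0 //; apply: ler_pM; rewrite ?mulr_ge0 //.
    by rewrite ler_pM2l //; apply: le_trans pF (HM a ar).
  exact: H4.
apply: le_trans T1 _; rewrite -exprMn -[leLHS]real_normK ?num_real //.
by rewrite ler_sqr ?nnegrE ?mulr_ge0 // /D; apply: HL.
Qed.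

Lemma uniformly_C1_norm_sq (c : R) :
  uniformly_C1 (fun x => `|x| ^+ 2 - c) (fun x => 2 *: x).
Proof.
split.
  move=> r; exists (r ^+ 2 + `|c|) => a ar; apply: le_trans (ler_normB _ _) _.
  by rewrite lerD2r ger0_norm ?sqr_ge0 // !expr2 ler_pM.
move=> r eps eps0; exists eps => // a h _ hd.
rewrite (normD_sq dotE) dotZl.
have -> : `|a| ^+ 2 + 2 * dot a h + `|h| ^+ 2 - c - (`|a| ^+ 2 - c) - 2 * dot a h
  = `|h| * `|h| by ring.
by rewrite normrM !normr_id ler_wpM2r.
Qed.

(** A quadratic spline in [|x|^2] that vanishes for [|x|^2 <= k] and equals [1]
    for [|x|^2 >= k + 1]. *)
Definition cutoff (k : R) (x : X) : R :=
  let p c := Num.max (`|x| ^+ 2 - c) 0 in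
  2 * p k ^+ 2 + (- 4 * p (k + 2^-1) ^+ 2 + 2 * p (k + 1) ^+ 2).

Definition cutoff_grad (k : R) (x : X) : X :=
  let q c := (2 * Num.max (`|x| ^+ 2 - c) 0) *: (2 *: x) in
  2 *: q k + (- 4 *: q (k + 2^-1) + 2 *: q (k + 1)).

Lemma uniformly_C1_cutoff k : uniformly_C1 (cutoff k) (cutoff_grad k).
Proof.
have sq c := uniformly_C1_pos_sq (uniformly_C1_norm_sq c).
apply: uniformly_C1_ext (uniformly_C1_lin 2 (sq k) (uniformly_C1_lin (- 4)
  (sq (k + 2^-1)) (uniformly_C1_lin 2 (sq (k + 1)) (uniformly_C1_cst 0)))) => x /=.
  by rewrite addr0.
by rewrite addr0.
Qed.

Lemma cutoff_inside k x : `|x| ^+ 2 <= k -> cutoff k x = 0 /\ cutoff_grad k x = 0.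
Proof.
move=> xk; have p0 c : k <= c -> Num.max (`|x| ^+ 2 - c) 0 = 0.
  by move=> kc; rewrite max_r // subr_le0 (le_trans xk).
rewrite /cutoff /cutoff_grad !p0 ?lerDl ?invr_ge0 //.
by rewrite !mulr0 expr0n /= !mulr0 !addr0 !scale0r !scaler0 !addr0.
Qed.

Lemma cutoff_outside k x : k + 1 <= `|x| ^+ 2 ->
  cutoff k x = 1 /\ cutoff_grad k x = 0.
Proof.
move=> xk; have pt c : c <= k + 1 -> Num.max (`|x| ^+ 2 - c) 0 = `|x| ^+ 2 - c.
  by move=> kc; rewrite max_l // subr_ge0 (le_trans kc).
have h1 : (2^-1 : R) <= 1 by lra.
rewrite /cutoff /cutoff_grad !pt ?lerDl ?lerD2l //.
split; first by lra.
rewrite !scalerA -!scalerDl.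
rewrite [X in X *: _](_ : _ = 0) ?scale0r //. rewrite -[LHS]/(_ * 2); lra.
Qed.

Variables (F : nat -> X -> R) (g : nat -> X -> X).

Fixpoint glued k : X -> R :=
  if k is k'.+1 then
    fun x => glued k' x + cutoff k'%:R x * (F k'.+1 x - glued k' x)
  else F 0.

Fixpoint glued_grad k : X -> X :=
  if k is k'.+1 then
    fun x => glued_grad k' x + (cutoff k'%:R x *: (g k'.+1 x - glued_grad k' x)
      + (F k'.+1 x - glued k' x) *: cutoff_grad k'%:R x)
  else g 0.

Lemma uniformly_C1_glued : (forall k, uniformly_C1 (F k) (g k)) ->
  forall k, uniformly_C1 (glued k) (glued_grad k).
Proof.
move=> Fg; elim=> [|k IH]; first exact: Fg.
apply: uniformly_C1_ext (uniformly_C1_lin 1 (uniformly_C1_mul (uniformly_C1_cutoff k%:R)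
  (uniformly_C1_lin (-1) IH (Fg k.+1))) IH) => x /=.
  by ring.
rewrite !scale1r ?scaleN1r ?mulN1r.
by rewrite addrC (addrC (- glued_grad k x)) (addrC (- glued k x)).
Qed.

Lemma glued_stable k m x : (k <= m)%N -> `|x| ^+ 2 <= k%:R ->
  glued m x = glued k x /\ glued_grad m x = glued_grad k x.
Proof.
move=> km xk; elim: m km => [|m IH]; first by rewrite leqn0 => /eqP ->.
rewrite leq_eqVlt => /orP[/eqP -> //|km]; have [<- <-] := IH km.
have [/= -> ->] : cutoff m%:R x = 0 /\ cutoff_grad m%:R x = 0.
  by apply: cutoff_inside; apply: le_trans xk _; rewrite ler_nat.
by rewrite mul0r scale0r scaler0 !addr0.
Qed.

(** Where the cutoff is neither [0] nor [1], both functions that it mixes agree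
    with the jet, so their difference vanishes there along with its gradient. *)
Lemma glued_jet x (c : R) (v : X) :
  (forall k, `|x| ^+ 2 <= k.+1%:R -> F k x = c /\ g k x = v) ->
  forall k, `|x| ^+ 2 <= k.+1%:R -> glued k x = c /\ glued_grad k x = v.
Proof.
move=> Fgx; elim=> [|k IH] xk /=; first exact: Fgx.
have [-> ->] := Fgx k.+1 xk.
have [/IH[-> ->]|xk1] := leP (`|x| ^+ 2) k.+1%:R.
  by rewrite !subrr mulr0 scaler0 scale0r !addr0.
have [|-> ->] := @cutoff_outside k%:R x; first by rewrite natr1 ltW.
by rewrite mul1r scale1r scaler0 !addr0 !subrKC.
Qed.

(** On each ball the sequence of glued functions is eventually constant. *)
Lemma uniformly_C1_gluing : (forall k, uniformly_C1 (F k) (g k)) ->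
  exists F' g', uniformly_C1 F' g' /\ forall x c v,
    (forall k, `|x| ^+ 2 <= k.+1%:R -> F k x = c /\ g k x = v) ->
    F' x = c /\ g' x = v.
Proof.
move=> Fg.
pose n (x : X) := Num.bound (`|x| ^+ 2).
have xn x : `|x| ^+ 2 <= (n x)%:R by apply/ltW/archi_boundP/sqr_ge0.
pose F' x := glued (n x) x; pose g' x := glued_grad (n x) x.
have stable x m : `|x| ^+ 2 <= m%:R -> F' x = glued m x /\ g' x = glued_grad m x.
  move=> xm; rewrite /F' /g'.
  have [H1 H2] := glued_stable (leq_maxl (n x) m) (xn x).
  have [H3 H4] := glued_stable (leq_maxr (n x) m) xm.
  by rewrite -H1 -H2 -H3 -H4.
have ball_stable r : exists m, forall x, `|x| <= r ->
    F' x = glued m x /\ g' x = glued_grad m x.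
  exists (Num.bound (r ^+ 2)) => x xr; apply: stable.
  apply: le_trans (ltW (archi_boundP (sqr_ge0 r))).
  by rewrite !expr2 ler_pM.
exists F', g'; split; last first.
  move=> x c v H; apply: (glued_jet H).
  by apply: le_trans (xn x) _; rewrite ler_nat.
split.
  move=> r; have [m Hm] := ball_stable r; have [M HM] := (uniformly_C1_glued Fg m).1 r.
  by exists M => a ar; rewrite (Hm a ar).1; exact: HM.
move=> r eps eps0; have [m Hm] := ball_stable (r + 1).
have [d d0 Hd] := (uniformly_C1_glued Fg m).2 r _ eps0.
exists (Num.min d 1); first by rewrite lt_min d0 ltr01.
move=> a h ar; rewrite le_min => /andP[hd h1].
have [Fa ga] : F' a = glued m a /\ g' a = glued_grad m a.
  by apply: Hm; apply: le_trans ar _; rewrite lerDl.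
have [Fah _] : F' (a + h) = glued m (a + h) /\ g' (a + h) = glued_grad m (a + h).
  by apply: Hm; apply: le_trans (ler_normD _ _) _; apply: lerD.
by rewrite Fa ga Fah; exact: Hd.
Qed.

End UniformC1.

(** * Uniform differentiability and the class [C1uB] *)

Lemma bounded_onP (R : realType) (V : normedModType R) (T : Type) (A : set T)
    (f : T -> V) :
  [bounded f x | x in A] <-> exists M, forall x, A x -> `|f x| <= M.
Proof.
split=> [[M [_ H]]|[M H]].
  exists (`|M| + 1) => x Ax.
  by apply: (H (`|M| + 1)) => //; have := ler_norm M; lra.
exists M; split; first exact: num_real.
by move=> y My x Ax; apply: le_trans (H x Ax) (ltW My).
Qed.

Section Gradient.
Variables (R : realType) (X : completeNormedModType R).
Variable dot : {dot X for idfun}.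
Hypothesis dotE : norm_from_dot dot.

Lemma diff_remainder (F : X -> R) (x : X) : differentiable F x ->
  forall eps, 0 < eps -> exists2 d, 0 < d & forall h, `|h| < d ->
    `|F (x + h) - F x - 'd F x h| <= eps * `|h|.
Proof.
move=> /diff_locally /eqaddoP Fx eps eps0.
have /nbhs_normP[d /= d0 Hd] := Fx eps eps0.
exists d => // h hd; have := Hd h.
rewrite /= sub0r normrN => /(_ hd).
by rewrite /cst /= !fctE /= opprD addrA (addrC h).
Qed.

Lemma differentiable_gradient (F : X -> R) (x : X) : differentiable F x ->
  forall v, 'd F x v = dot (gradient dot F x) v.
Proof.
move=> Fx; suff [g Hg] : exists g, forall v, 'd F x v = dot g v.
  by apply: (@getPex _ [set g | forall v, 'd F x v = dot g v]); exists g.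
have dc : continuous ('d F x) by apply: diff_continuous.
have /linear_boundedP[M [_ HM]] := (linear_bounded_continuous ('d F x)).2 dc.
apply: (riesz dotE (M := M + 1)) => [a u v|v]; first by rewrite linearP.
by apply: HM; rewrite ltrDl.
Qed.

Lemma is_derive_along_line (F : X -> R) (a h : X) (t : R) :
  differentiable F (a + t *: h) ->
  is_derive t 1 (fun s : R => F (a + s *: h)) ('d F (a + t *: h) h).
Proof.
move=> Fd; suff cv : (s^-1 *: (((fun s : R => F (a + s *: h)) \o shift t) (s *: 1)
    - F (a + t *: h))) @[s --> 0^'] --> 'd F (a + t *: h) h.
  by apply: DeriveDef; [exact: cvgP cv | exact: cvg_lim cv].
apply/cvgrPdist_le => eps eps0.
have e1 : 0 < eps / (`|h| + 1) by rewrite divr_gt0 // ltr_wpDl.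
have [d d0 Hd] := diff_remainder Fd e1.
have d1 : 0 < d / (`|h| + 1) by rewrite divr_gt0 // ltr_wpDl.
near=> s.
have s0 : s != 0 by near: s; exact: nbhs_dnbhs_neq.
have sd : `|s| < d / (`|h| + 1) by near: s; exact: dnbhs0_lt.
have shd : `|s *: h| < d.
  rewrite normrZ; move: sd; rewrite ltr_pdivlMr ?ltr_wpDl //.
  by have := normr_ge0 s; lra.
have sp : 0 < `|s| by rewrite normr_gt0.
have := Hd _ shd; rewrite linearZ /=.
have -> : a + t *: h + s *: h = a + (s *: 1 + t) *: h.
  by rewrite -[s *: 1]/(s * 1) mulr1 -addrA (addrC s) scalerDl.
rewrite normrZ; set F1 := F (a + (s *: 1 + t) *: h).
set F0 := F (a + t *: h); set D := 'd F _ h => H.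
suff : `|D - s^-1 * (F1 - F0)| <= eps by [].
have -> : D - s^-1 * (F1 - F0) = - (s^-1 * (F1 - F0 - s *: D)).
  by rewrite -[s *: D]/(s * D); field.
rewrite normrN normrM normfV ler_pdivrMl //; apply: le_trans H _.
rewrite mulrCA ler_wpM2l // mulrAC ler_pdivrMr ?ltr_wpDl //.
by rewrite ler_wpM2l ?(ltW eps0) // lerDl.
Unshelve. all: by end_near. Qed.

Lemma dot_as_linear (g : X) : exists2 L : {linear X -> R},
  (forall v, L v = dot g v) & continuous L.
Proof.
have Llin : linear (dot g : X -> R).
  by move=> a u v; rewrite dotDr dotZr.
pose LM := GRing.isLinear.Build _ _ _ _ _ Llin.
pose L : {linear X -> R} := HB.pack (dot g : X -> R) LM.
exists L => //; apply/linear_bounded_continuous/linear_boundedP.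
exists `|g|; split; first exact: num_real.
move=> r gr x; apply: le_trans (norm_dot_le dotE g x) _.
by rewrite ler_wpM2r // ltW.
Qed.

Lemma differentiable_of_remainder (F : X -> R) (x g : X) :
  (forall eps, 0 < eps -> exists2 d, 0 < d & forall h, `|h| <= d ->
     `|F (x + h) - F x - dot g h| <= eps * `|h|) ->
  differentiable F x /\ forall v, 'd F x v = dot g v.
Proof.
move=> H; have [L Lg Lc] := dot_as_linear g.
have FL : F \o shift x = cst (F x) + L +o_ 0 id.
  apply/eqaddoP => eps eps0; have [d d0 Hd] := H _ eps0.
  apply/nbhs_normP; exists d => // h; rewrite /= sub0r normrN => /ltW hd.
  have := Hd h hd; rewrite /= -Lg.
  by rewrite /cst /= !fctE /= opprD addrA (addrC h).
have dL := diff_unique Lc FL.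
split; last by move=> v; rewrite dL Lg.
by apply/diff_locallyP; rewrite dL.
Qed.

(** The three-point identity behind this estimate compares the increments of
    [F] along the sides of a triangle with vertices [a], [b] and [b + k]. *)
Lemma uniformly_differentiable_continuous (F : X -> R) (g : X -> X)
    (r eps : R) : uniformly_differentiable dot F g -> 0 < eps ->
  exists2 d, 0 < d & forall a b, `|a| <= r -> `|b| <= r -> `|b - a| <= d ->
    `|g b - g a| <= eps.
Proof.
move=> Fg eps0; have e4 : 0 < eps / 4 by rewrite divr_gt0.
have [d d0 Hd] := Fg r _ e4; exists (d / 2); first by rewrite divr_gt0.
move=> a b ar br bad; set v := g b - g a.
have [->|v0] := eqVneq v 0; first by rewrite normr0 ltW.
have vp : 0 < `|v| by rewrite normr_gt0.
have [ba|ba] := eqVneq b a; first by rewrite /v ba subrr normr0 ltW.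
pose rho := `|b - a|; have rp : 0 < rho by rewrite normr_gt0 subr_eq0.
pose k := (rho / `|v|) *: v.
have kr : `|k| = rho.
  by rewrite normrZ ger0_norm ?divr_ge0 ?(ltW rp) // mulfVK // gt_eqF.
have kv : dot v k = rho * `|v|.
  by rewrite dotZr -dotE expr2 mulrA mulfVK // gt_eqF.
have rd : rho <= d / 2 by [].
have s2 : `|b - a + k| <= 2 * rho.
  by apply: le_trans (ler_normD _ _) _; rewrite kr -/rho; lra.
have E1 := Hd b k br; rewrite kr in E1.
have E2 := Hd a (b - a + k) ar; have E3 := Hd a (b - a) ar.
rewrite -/rho in E3.
have {}E1 := E1 _; have {}E3 := E3 _.
have rd' : rho <= d by lra.
have {}E1 := E1 rd'; have {}E3 := E3 rd'.
have {}E2 : `|F (a + (b - a + k)) - F a - dot (g a) (b - a + k)|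
    <= eps / 4 * (2 * rho).
  apply: le_trans (E2 _) _; first by lra.
  by rewrite ler_wpM2l // ltW.
rewrite addrA subrKC dotDr // in E2; rewrite subrKC in E3.
have : rho * `|v| <= rho * eps.
  rewrite -kv /v dotBl; move: E1 E2 E3; rewrite !ler_norml.
  move=> /andP[E1 E1'] /andP[E2 E2'] /andP[E3 E3']; lra.
by rewrite ler_pM2l.
Qed.

Lemma uniformly_differentiable_C1uB (F : X -> R) (g : X -> X) :
  uniformly_differentiable dot F g ->
  C1uB dot F /\ forall x, gradient dot F x = g x.
Proof.
move=> Fg.
have dF x : differentiable F x /\ forall v, 'd F x v = dot (g x) v.
  apply: differentiable_of_remainder => eps eps0.
  by have [d d0 Hd] := Fg `|x| _ eps0; exists d => // h; apply: Hd.
have gradE x : gradient dot F x = g x.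
  apply: (dot_inj dotE) => v.
  by rewrite -(differentiable_gradient (dF x).1) (dF x).2.
split => //; split=> [x|B /bounded_onP[r Br]]; first exact: (dF x).1.
apply/unif_continuousP => eps eps0.
have e2 : 0 < eps / 2 by rewrite divr_gt0.
have [d d0 Hd] := uniformly_differentiable_continuous r Fg e2.
exists d => // -[x y] /=; rewrite ball_subspace_ball /subspace_ball.
case: ifP => [|_ ->]; last exact: ballxx.
rewrite inE => Bx [By]; rewrite -!ball_normE /= !gradE => xy.
apply: (@le_lt_trans _ _ (eps / 2)); last by lra.
by apply: Hd; [exact: Br | exact: Br | exact: ltW].
Qed.

(** The mean value theorem on a segment turns the modulus of continuity of the
    gradient into a bound on the first-order remainder. *)
Lemma C1uB_uniformly_differentiable (F : X -> R) :
  C1uB dot F -> uniformly_differentiable dot F (gradient dot F).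
Proof.
move=> [dF gF] r eps eps0; set g := gradient dot F.
pose B := [set x : X | `|x| <= r + 1].
have /gF/unif_continuousP/(_ eps eps0)[d d0 Hd] : bounded_set B.
  by apply/bounded_onP; exists (r + 1).
have {}Hd x y : `|x| <= r + 1 -> `|y| <= r + 1 -> `|x - y| < d ->
    `|g x - g y| <= eps.
  move=> xr yr xy; have := Hd (x, y).
  rewrite /= ball_subspace_ball /subspace_ball mem_set //=.
  by rewrite -!ball_normE /= => H; apply/ltW/H; split.
exists (Num.min (d / 2) 1); first by rewrite lt_min divr_gt0 //=.
move=> a h ar; rewrite le_min => /andP[hd h1].
pose phi (t : R) := F (a + t *: h) - t * dot (g a) h.
pose dphi (t : R) := dot (g (a + t *: h)) h - dot (g a) h.
have phi_derive (t : R) : is_derive t 1 phi (dphi t).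
  have Fline := is_derive_along_line (dF (a + t *: h)).
  rewrite (differentiable_gradient (dF _)) in Fline.
  have lin : is_derive t 1 (fun s : R => s * dot (g a) h) (dot (g a) h).
    by apply: is_derive_eq; rewrite scaler0 add0r /GRing.scale /= mulr1.
  exact: is_deriveB.
have phi_cont : {within `[0, 1], continuous phi}.
  by apply: derivable_within_continuous => t _; apply: ex_derive.
have [t] := @MVT R phi dphi 0 1 ltr01 (fun t _ => phi_derive t) phi_cont.
rewrite in_itv /= => /andP[t0 t1].
rewrite /phi scale1r scale0r addr0 mul1r mul0r !subr0 mulr1 => E.
have th : `|t *: h| <= `|h|.
  by rewrite normrZ gtr0_norm // ler_piMl // ltW.
have -> : F (a + h) - F a - dot (g a) h = dphi t by rewrite -E; ring.
rewrite /dphi -dotBl; apply: le_trans (norm_dot_le dotE _ _) _.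
rewrite ler_wpM2r //; apply: Hd.
- by apply: le_trans (ler_normD _ _) _; rewrite lerD // (le_trans th).
- by rewrite (le_trans ar) // lerDl.
- by rewrite addrC addKr; lra.
Qed.

End Gradient.

(** * The extension theorem *)

Lemma cvg0_of_eventually_le (R : realType) (u : nat -> R) :
  (forall eps, 0 < eps -> exists N, forall n, (N <= n)%N -> `|u n| <= eps) ->
  u n @[n --> \oo] --> 0.
Proof.
move=> H; apply/cvgrPdist_le => eps /H[N HN].
by exists N => // n /= Nn; rewrite sub0r normrN; exact: HN.
Qed.

(** Sequences violating the modulus at the scales [1 / n] would contradict the
    sequential condition. *)
Lemma sequential_uniform_compat (R : realType) (X : normedModType R)
    (dot : {dot X for idfun}) (E A : set X) (f : E -> R) (G : E -> X) :
  (forall (x : nat -> X) (y z : nat -> E),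
     bounded_fun x ->
     bounded_fun (fun n => val (y n)) ->
     bounded_fun (fun n => val (z n)) ->
     (forall n, 0 < `|x n - val (y n)| + `|x n - val (z n)|) ->
     `|x n - val (y n)| + `|x n - val (z n)| @[n --> \oo] --> 0 ->
     (f (y n) + dot (G (y n)) (x n - val (y n))
        - f (z n) - dot (G (z n)) (x n - val (z n)))
       / (`|x n - val (y n)| + `|x n - val (z n)|) @[n --> \oo] --> 0) ->
  bounded_set A ->
  forall eps, 0 < eps -> exists2 d, 0 < d & forall (i j : E) (x : X),
    A (val i) -> A (val j) -> `|x - val i| + `|x - val j| <= d ->
    affine_jet dot (f i) (val i) (G i) x - affine_jet dot (f j) (val j) (G j) x
      <= eps * (`|x - val i| + `|x - val j|).
Proof.
move=> H /bounded_onP[M AM] eps eps0; apply: contrapT => noD.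
have /choice[w Hw] : forall n, exists w : E * E * X,
    [/\ A (val w.1.1), A (val w.1.2),
       `|w.2 - val w.1.1| + `|w.2 - val w.1.2| <= n.+1%:R^-1 &
       eps * (`|w.2 - val w.1.1| + `|w.2 - val w.1.2|) <
         affine_jet dot (f w.1.1) (val w.1.1) (G w.1.1) w.2
         - affine_jet dot (f w.1.2) (val w.1.2) (G w.1.2) w.2].
  move=> n; apply: contrapT => no_w; apply: noD.
  exists n.+1%:R^-1; first by rewrite invr_gt0 ltr0Sn.
  move=> i j x Ai Aj xij; rewrite leNgt; apply/negP => lt; apply: no_w.
  by exists (i, j, x).
pose y n := (w n).1.1; pose z n := (w n).1.2; pose x n := (w n).2.
pose s n := `|x n - val (y n)| + `|x n - val (z n)|.
have s0 n : 0 < s n.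
  rewrite lt_def addr_ge0 // andbT; apply/negP => /eqP sn0.
  have [_ _ _] := Hw n; rewrite -/(x n) -/(y n) -/(z n) -/(s n) sn0 mulr0.
  have xy : x n = val (y n).
    apply/eqP; rewrite -subr_eq0 -normr_eq0 eq_le normr_ge0 andbT.
    by rewrite -sn0 lerDl.
  have xz : x n = val (z n).
    apply/eqP; rewrite -subr_eq0 -normr_eq0 eq_le normr_ge0 andbT.
    by rewrite -sn0 lerDr.
  have -> : y n = z n by apply: val_inj; rewrite -xy -xz.
  by rewrite subrr ltxx.
have sn n : s n <= n.+1%:R^-1 by have [] := Hw n.
have yM n : `|val (y n)| <= M by have [/AM] := Hw n.
have zM n : `|val (z n)| <= M by have [_ /AM] := Hw n.
have xM n : `|x n| <= M + 1.
  rewrite -(subrK (val (y n)) (x n)); apply: le_trans (ler_normD _ _) _.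
  rewrite addrC lerD //; apply: le_trans (le_trans (sn n) _).
    by rewrite lerDl.
  by rewrite invf_le1 ?ltr0Sn // ler1n.
have s_cvg : s n @[n --> \oo] --> 0.
  apply: cvg0_of_eventually_le => e e0; have [N HN] := sum_inv_succ_small ler01 e0.
  exists N => n /HN; rewrite mul1r ger0_norm ?(ltW (s0 n)) //.
  by apply: le_trans (sn n).
have := H x y z _ _ _ s0 s_cvg.
have bx : bounded_fun x by apply/bounded_onP; exists (M + 1) => n _.
have by_ : bounded_fun (fun n => val (y n)) by apply/bounded_onP; exists M => n _.
have bz : bounded_fun (fun n => val (z n)) by apply/bounded_onP; exists M => n _.
move=> /(_ bx by_ bz)/cvgrPdist_le/(_ eps eps0)[N _ /(_ N (leqnn N))] /=.
rewrite sub0r normrN -/(s N) ler_norml => /andP[_].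
rewrite ler_pdivrMr // => le_N; have [_ _ _] := Hw N.
by rewrite -/(x N) -/(y N) -/(z N) -/(s N) /affine_jet; lra.
Qed.

Theorem theorem6p1 (R : realType) (X : completeNormedModType R)
    (dot : {dot X for idfun}) (dotE : norm_from_dot dot)
    (E : set X) (f : E -> R) (G : E -> X)
    (fG_bounded : jet_bounded_on_bounded f G) :
  (exists F : X -> R, C1uB dot F /\
     forall y : E, F (val y) = f y /\ gradient dot F (val y) = G y)
  <->
  (forall (x : nat -> X) (y z : nat -> E),
     bounded_fun x ->
     bounded_fun (fun n => val (y n)) ->
     bounded_fun (fun n => val (z n)) ->
     (forall n, 0 < `|x n - val (y n)| + `|x n - val (z n)|) ->
     `|x n - val (y n)| + `|x n - val (z n)| @[n --> \oo] --> 0 ->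
     (f (y n) + dot (G (y n)) (x n - val (y n))
        - f (z n) - dot (G (z n)) (x n - val (z n)))
       / (`|x n - val (y n)| + `|x n - val (z n)|) @[n --> \oo] --> 0).
Proof.
split=> [[F [FC1 Fjet]] x y z bx yb zb s0 s_cvg|compat].
  have FG := C1uB_uniformly_differentiable dotE FC1.
  have [My HMy] := (bounded_onP _ _).1 yb.
  have [Mz HMz] := (bounded_onP _ _).1 zb.
  apply: cvg0_of_eventually_le => eps eps0.
  have [d d0 Hd] := FG (Num.max My Mz) _ eps0.
  have [N _ HN] := (cvgrPdist_le _ _).1 s_cvg _ d0.
  exists N => n Nn; have := HN n Nn; rewrite /= sub0r normrN.
  rewrite ger0_norm ?(ltW (s0 n)) // => sd.
  have yd : `|x n - val (y n)| <= d by apply: le_trans sd; rewrite lerDl.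
  have zd : `|x n - val (z n)| <= d by apply: le_trans sd; rewrite lerDr.
  have yM : `|val (y n)| <= Num.max My Mz by rewrite le_max HMy.
  have zM : `|val (z n)| <= Num.max My Mz by rewrite le_max HMz ?orbT.
  have := Hd _ _ yM yd; have := Hd _ _ zM zd.
  have [-> ->] := Fjet (y n); have [-> ->] := Fjet (z n); rewrite !subrKC.
  rewrite normrM normfV (gtr0_norm (s0 n)) ler_pdivrMr // mulrDr !ler_norml.
  by move=> /andP[? ?] /andP[? ?]; apply/andP; split; lra.
pose A k := [set x : X | `|x| ^+ 2 <= k.+1%:R].
have A_bounded k : bounded_set (A k).
  apply/bounded_onP; exists (k.+1%:R + 1) => x; rewrite /A /= => xk.
  have := sqr_ge0 (`|x| - 1); have := ler0n R k.+1.
  have -> : (`|x| - 1) ^+ 2 = `|x| ^+ 2 - 2 * `|x| + 1 by ring.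
  lra.
have /choice[Fg HFg] : forall k, exists Fg : (X -> R) * (X -> X),
    uniformly_C1 dot Fg.1 Fg.2 /\ forall y : E, A k (val y) ->
      Fg.1 (val y) = f y /\ Fg.2 (val y) = G y.
  move=> k; pose B := [set y : E | A k (val y)].
  have [|/bounded_onP[Kf HKf] /bounded_onP[KG HKG]] := fG_bounded B.
    have /bounded_onP[M HM] := A_bounded k.
    by apply/bounded_onP; exists M => _ [y By <-]; exact: HM.
  have fGK y : B y -> `|f y| <= Num.max Kf KG /\ `|G y| <= Num.max Kf KG.
    by move=> By; rewrite !le_max HKf // HKG // orbT.
  have [eps eps0|F [g [Fb Fd Fjet]]] :=
    bounded_jet_extension dotE (p := fun y : E => val y) fGK.
    have [d d0 Hd] := sequential_uniform_compat compat (A_bounded k) eps0.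
    by exists d => // i j x Bi Bj; exact: Hd.
  by exists (F, g).
have [F [g [FC1 Fjet]]] := uniformly_C1_gluing dotE (F := fun k => (Fg k).1)
  (g := fun k => (Fg k).2) (fun k => (HFg k).1).
have [C1F gradE] := uniformly_differentiable_C1uB dotE FC1.2.
exists F; split => // y; rewrite gradE.
by apply: Fjet => k yk; apply: (HFg k).2.
Qed.
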